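(* There exist a separable complex Hilbert space $(\mathcal{H}, \langle\cdot,\cdot\rangle_{\mathcal{H}})$, a bounded and boundedly invertible linear map $T\colon \mathcal{H}\to\mathcal{H}$ which has no eigenvalues, and a $T$-invariant probability measure $\varrho$ on $\mathcal{H}$ (equipped with the Borel $\sigma$-algebra) which is non-trivial, i.e. $\varrho\neq\delta_0$.
   Context: A Borel probability measure $\varrho$ on $\mathcal{H}$ is called $T$-invariant if $\varrho(T^{-1}(B))=\varrho(B)$ for every Borel set $B\subseteq\mathcal{H}$. It is called non-trivial if $\varrho\neq\delta_0$, where $\delta_0$ is the Dirac measure at $0\in\mathcal{H}$. ''Boundedly invertible'' means that $T$ is bijective with bounded inverse. An eigenvalue of $T$ is a $\lambda\in\mathbb{C}$ such that $Tx=\lambda x$ for some $x\in\mathcal{H}\setminus\{0\}$. *)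

(* Defs.v *)
From HB Require Import structures.
From mathcomp Require Import all_boot all_order all_algebra.
From mathcomp Require Import sesquilinear complex.
From mathcomp Require Import all_classical all_reals all_analysis.

Set Implicit Arguments.
Unset Strict Implicit.
Unset Printing Implicit Defensive.

Import Order.TTheory GRing.Theory Num.Theory.
Import numFieldNormedType.Exports.

Local Open Scope classical_set_scope.
Local Open Scope ring_scope.

(* A complex Hilbert space: a Banach space over R[i] whose norm is induced by
   an inner product, linear in its first argument and conjugate-linear in its
   second. *)
HB.mixin Record BanachSpace_isHilbert (R : realType) H
    of CompleteNormedModule R[i] H := {
  inner : {dot H for (@Num.conj R[i])} ;
  inner_normE : forall x : H, inner x x = `|x| ^+ 2 }.

#[short(type="hilbertType")]
HB.structure Definition Hilbert (R : realType) :=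
  { H of CompleteNormedModule R[i] H & BanachSpace_isHilbert R H }.

Definition separable_space (T : topologicalType) : Prop :=
  exists2 D : set T, countable D & dense D.

Definition borel (T : ptopologicalType) := g_sigma_algebraType (@open T).

Section operators.
Variables (K : numFieldType) (V : normedModType K).

(* As [0 <= `|x|], any bound [M] is a real number unless [V] is trivial. *)
Definition bounded_operator (f : V -> V) : Prop :=
  exists M : K, forall x, `|f x| <= M * `|x|.

Definition boundedly_invertible (f : V -> V) : Prop :=
  exists g : V -> V, [/\ cancel f g, cancel g f & bounded_operator g].

Definition is_eigenvalue (f : V -> V) (lambda : K) : Prop :=
  exists2 x : V, x != 0 & f x = lambda *: x.

End operators.

Section measures.
Context {d : measure_display} {T : measurableType d} {R : realType}.

Definition invariant_measure (f : T -> T) (mu : {measure set T -> \bar R}) :=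
  forall B, measurable B -> mu (f @^-1` B) = mu B.

(* A measure is a function on all subsets, with arbitrary values outside the
   sigma-algebra; equality of measures only concerns measurable sets. *)
Definition same_measure (mu nu : {measure set T -> \bar R}) :=
  forall B, measurable B -> mu B = nu B.

End measures.

(* Main.v *)
From HB Require Import structures.
Require Import Defs.
From mathcomp Require Import all_boot all_order all_algebra.
From mathcomp Require Import sesquilinear complex.
From mathcomp Require Import zify ring lra.
From mathcomp Require Import all_classical all_reals all_analysis.
From mathcomp Require Import measurable_realfun.

(* Let N_j = 4^j.  The vectors are the finitely additive complex measures on
   the 4-adic odometer (the inverse limit of the cyclic groups Z/N_j), recorded
   by their values x j k on the k-th cylinder of level j, subject to
   sum_j sum_(k < N_j) w(j,k) |x j k|^2 < oo.  T is the shift x j k |-> x j (k+1).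
   The weight is w(j,k) = (2^j / 2^d)^4, d being the distance of k to N_j Z.
   An eigenvector would be a multiple of a Haar measure twisted by a character:
   |x j k| is of order 1/N_j for every k, and since w(j,0) = 16^j = N_j^2 the
   terms of the series do not tend to 0.  So T has no eigenvalue.
   Yet the point mass at a point omega has squared norm
   sum_j w(j, omega mod N_j), which is finite for Haar-almost every omega because
   E[w(j, omega mod N_j)^(1/4)] <= 4 / 2^j is summable.  The law of this random
   vector is T-invariant because Haar measure is translation invariant. *)

Set Implicit Arguments.
Unset Strict Implicit.
Unset Printing Implicit Defensive.

Import Order.TTheory GRing.Theory Num.Theory.
Import numFieldNormedType.Exports.

Local Open Scope classical_set_scope.
Local Open Scope ring_scope.

(** * Complex series *)

Section complex_aux.
Variable R : realType.
Implicit Types (z w : R[i]) (x : R).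

Definition sqnormc z : R := complex.Re z ^+ 2 + complex.Im z ^+ 2.

Lemma sqnormc_ge0 z : 0 <= sqnormc z.
Proof. by rewrite addr_ge0 ?sqr_ge0. Qed.

Lemma sqnormc0 : sqnormc 0 = 0.
Proof. by rewrite /sqnormc /= expr0n addr0. Qed.

Lemma sqnormc_eq0 z : sqnormc z = 0 -> z = 0.
Proof.
case: z => a b /eqP; rewrite /sqnormc /= paddr_eq0 ?sqr_ge0 //.
by rewrite !expf_eq0 /= => /andP[/eqP-> /eqP->].
Qed.

Lemma sqnormcM z w : sqnormc (z * w) = sqnormc z * sqnormc w.
Proof. by case: z w => [a b] [c d]; rewrite /sqnormc /=; ring. Qed.

Lemma sqnormcE z : (sqnormc z)%:C%C = `|z| ^+ 2.
Proof. by rewrite add_Re2_Im2. Qed.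

Lemma sqnormcN z : sqnormc (- z) = sqnormc z.
Proof. by case: z => a b; rewrite /sqnormc /=; ring. Qed.

Lemma mulc_conj z : z * z^*%C = (sqnormc z)%:C%C.
Proof. by rewrite sqnormcE sqr_normc. Qed.

(* Optimising over [t] turns this into Minkowski's inequality for sums. *)
Lemma sqnormcD_le (t : R) z w : 0 < t ->
  sqnormc (z + w) <= (1 + t) * sqnormc z + (1 + t^-1) * sqnormc w.
Proof.
move=> t0; have t0' : t != 0 by rewrite gt_eqF.
case: z w => [a b] [c d]; rewrite /sqnormc /=.
rewrite -subr_ge0 -(pmulr_rge0 _ t0).
suff -> : t * ((1 + t) * (a ^+ 2 + b ^+ 2) + (1 + t^-1) * (c ^+ 2 + d ^+ 2) -
    ((a + c) ^+ 2 + (b + d) ^+ 2)) = (t * a - c) ^+ 2 + (t * b - d) ^+ 2.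
  by rewrite addr_ge0 ?sqr_ge0.
by field.
Qed.

Lemma ReM_conj_le z w :
  `|complex.Re (z * w^*%C)| <= sqnormc z + sqnormc w.
Proof.
case: z w => [a b] [c d]; rewrite /sqnormc /= ler_norml.
have := sqr_ge0 (a - c); have := sqr_ge0 (a + c).
have := sqr_ge0 (b - d); have := sqr_ge0 (b + d).
have := sqr_ge0 a; have := sqr_ge0 b.
have := sqr_ge0 c; have := sqr_ge0 d.
by move=> *; apply/andP; split; nra.
Qed.

Lemma ImM_conj_le z w :
  `|complex.Im (z * w^*%C)| <= sqnormc z + sqnormc w.
Proof.
case: z w => [a b] [c d]; rewrite /sqnormc /= ler_norml.
have := sqr_ge0 (a - d); have := sqr_ge0 (a + d).
have := sqr_ge0 (b - c); have := sqr_ge0 (b + c).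
have := sqr_ge0 a; have := sqr_ge0 b.
have := sqr_ge0 c; have := sqr_ge0 d.
by move=> *; apply/andP; split; nra.
Qed.

(** Complex series are handled through their real and imaginary parts, so that the results on real
    series apply to each part. *)
Definition csummable (u : nat -> R[i]) :=
  cvgn (series (fun n => complex.Re (u n))) /\
  cvgn (series (fun n => complex.Im (u n))).

Definition csum (u : nat -> R[i]) : R[i] :=
  Complex (limn (series (fun n => complex.Re (u n))))
          (limn (series (fun n => complex.Im (u n)))).

Lemma csumD u v : csummable u -> csummable v ->
  csum (fun n => u n + v n) = csum u + csum v.
Proof.
move=> [ur ui] [vr vi]; rewrite /csum.
have -> : (fun n => complex.Re (u n + v n)) =
    (fun n => complex.Re (u n)) + (fun n => complex.Re (v n)).
  by apply/funext => n; rewrite raddfD.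
have -> : (fun n => complex.Im (u n + v n)) =
    (fun n => complex.Im (u n)) + (fun n => complex.Im (v n)).
  by apply/funext => n; rewrite raddfD.
by rewrite !lim_seriesD.
Qed.

Lemma csumZ a u : csummable u -> csum (fun n => a * u n) = a * csum u.
Proof.
case: a => a b [ur ui]; rewrite /csum.
have -> : (fun n => complex.Re (Complex a b * u n)) =
    a *: (fun n => complex.Re (u n)) - b *: (fun n => complex.Im (u n)).
  by apply/funext => n /=; rewrite !fctE; case: (u n) => c d.
have -> : (fun n => complex.Im (Complex a b * u n)) =
    a *: (fun n => complex.Im (u n)) + b *: (fun n => complex.Re (u n)).
  by apply/funext => n /=; rewrite !fctE; case: (u n) => c d.
have cZ (k : R) (v : nat -> R) : cvgn (series v) -> cvgn (series (k *: v)).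
  exact: is_cvg_seriesZ.
have lZ (k : R) (v : nat -> R) : cvgn (series v) ->
    limn (series (k *: v)) = k * limn (series v).
  exact: lim_seriesZ.
rewrite lim_seriesB ?lim_seriesD; try exact: cZ.
by rewrite !lZ.
Qed.

Lemma csum_conj u : csummable u -> csum (fun n => (u n)^*%C) = (csum u)^*%C.
Proof.
move=> [ur ui]; rewrite /csum /=; congr Complex.
  by congr (limn (series _)); apply/funext => n /=; case: (u n).
rewrite -lim_seriesN //; congr (limn (series _)).
by apply/funext => n /=; rewrite !fctE; case: (u n) => c d.
Qed.

Lemma csum_real (u : nat -> R) :
  csum (fun n => (u n)%:C%C) = (limn (series u))%:C%C.
Proof.
rewrite /csum /=; congr Complex; rewrite (_ : series _ = cst 0) ?lim_cst //.
by apply/funext => n; rewrite /series /= big1.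
Qed.

End complex_aux.

(** * The weights *)

Section weights.

Definition cycle_dist (j k : nat) : nat :=
  minn (k %% 4 ^ j) (4 ^ j - k %% 4 ^ j).

Lemma expn4_gt0 j : (0 < 4 ^ j)%N.
Proof. by rewrite expn_gt0. Qed.

Lemma cycle_dist0 j : cycle_dist j 0 = 0%N.
Proof. by rewrite /cycle_dist mod0n min0n. Qed.

Lemma cycle_distDperiod j k : cycle_dist j (k + 4 ^ j) = cycle_dist j k.
Proof. by rewrite /cycle_dist modnDr. Qed.

Lemma cycle_distS j k : (cycle_dist j k.+1 <= (cycle_dist j k).+1)%N /\
  (cycle_dist j k <= (cycle_dist j k.+1).+1)%N.
Proof.
have N0 := expn4_gt0 j; rewrite /cycle_dist modnS.
case: ifPn => [|_]; last by have := ltn_pmod k N0; lia.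
(* Here the residue of [k.+1] wraps around to 0, so [k %% 4 ^ j] must be the last residue; any other
   value is refuted by divisibility. *)
have [->|rN] := eqVneq (k %% 4 ^ j)%N (4 ^ j).-1; first by lia.
rewrite {1}(divn_eq k (4 ^ j)) -addnS dvdn_addr ?dvdn_mull //.
by move=> /dvdn_leq; have := ltn_pmod k N0; lia.
Qed.

Variable R : realType.

(** The fourth root of the weight. The weight at 0 must reach 16^j to exclude eigenvectors, but only
    this root has a mean over the residues that is summable in j. *)
Definition amp (j k : nat) : R := 2 ^+ j / 2 ^+ cycle_dist j k.

Definition wt (j k : nat) : R := amp j k ^+ 4.

Lemma amp_gt0 j k : 0 < amp j k.
Proof. by rewrite divr_gt0 // exprn_gt0. Qed.

Lemma wt_gt0 j k : 0 < wt j k.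
Proof. by rewrite exprn_gt0 // amp_gt0. Qed.

Lemma wt0 j : wt j 0 = 16 ^+ j.
Proof.
rewrite /wt /amp cycle_dist0 expr0 divr1 -exprM mulnC exprM.
by congr (_ ^+ _); ring.
Qed.

Lemma ampDperiod j k : amp j (k + 4 ^ j) = amp j k.
Proof. by rewrite /amp cycle_distDperiod. Qed.

Lemma wtDperiod j k : wt j (k + 4 ^ j) = wt j k.
Proof. by rewrite /wt ampDperiod. Qed.

Lemma amp_mod j k : amp j (k %% 4 ^ j) = amp j k.
Proof. by rewrite /amp /cycle_dist modn_mod. Qed.

Lemma amp_le2 j k l : (cycle_dist j l <= (cycle_dist j k).+1)%N ->
  amp j k <= 2 * amp j l.
Proof.
move=> lk; rewrite /amp mulrCA ler_pM2l ?exprn_gt0 //.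
rewrite -[2 / _]invf_div lef_pV2 ?posrE ?divr_gt0 ?exprn_gt0 //.
by rewrite ler_pdivrMr // -exprSr ler_eXn2l // ltr1n.
Qed.

Lemma wt_le16 j k l : amp j k <= 2 * amp j l -> wt j k <= 16 * wt j l.
Proof.
move=> kl; rewrite /wt (_ : 16 = 2 ^+ 4); last by ring.
by rewrite -exprMn lerXn2r // nnegrE ?mulr_ge0 // ltW // amp_gt0.
Qed.

(** One step along the cycle changes the distance to 0 by at most 1, hence the weight by a factor of
    at most 2^4. The two directions bound the inverse shift and the shift, with norms at most 4. *)
Lemma wtS_le j k : wt j k.+1 <= 16 * wt j k.
Proof. by apply/wt_le16/amp_le2; have [] := cycle_distS j k. Qed.

Lemma wt_leS j k : wt j k <= 16 * wt j k.+1.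
Proof. by apply/wt_le16/amp_le2; have [] := cycle_distS j k. Qed.

Lemma sum_half_le n : \sum_(k < n) (2 ^+ k)^-1 <= 2 :> R.
Proof.
suff -> : \sum_(k < n) (2 ^+ k)^-1 = 2 - 2 / 2 ^+ n :> R.
  by rewrite lerBlDr lerDl divr_ge0 // exprn_ge0.
elim: n => [|n IH]; first by rewrite big_ord0 expr0 divr1 subrr.
rewrite big_ord_recr /= IH exprS.
have : 2 ^+ n != 0 :> R by rewrite expf_neq0.
by move=> ?; field.
Qed.

(** The amplitudes decay geometrically from both ends of the cycle, and each end contributes at most
    2 * 2^j. *)
Lemma sum_amp_le j : \sum_(k < 4 ^ j) amp j k <= 4 * 2 ^+ j.
Proof.
set N := (4 ^ j)%N.
(* The minimum of the two exponents is replaced by the sum of both terms. Lowering N - k to N - k.+1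
   lets the reversal of the index below turn the second half into the same geometric sum. *)
have le1 (k : 'I_N) : amp j k <=
    2 ^+ j * ((2 ^+ k)^-1 + (2 ^+ (N - k.+1))^-1).
  rewrite /amp ler_pM2l ?exprn_gt0 // /cycle_dist modn_small //.
  have [kN|kN] := leqP k (4 ^ j - k); first by rewrite lerDl invr_ge0 exprn_ge0.
  rewrite -[leLHS]add0r lerD ?invr_ge0 ?exprn_ge0 //.
  rewrite lef_pV2 ?posrE ?exprn_gt0 // ler_eXn2l ?ltr1n //.
  by rewrite leq_sub2l.
apply: le_trans (ler_sum _ (fun k _ => le1 k)) _.
rewrite -mulr_sumr mulrC ler_pM2r ?exprn_gt0 // big_split /=.
rewrite (_ : 4 = 2 + 2); last by ring.
apply: lerD; first exact: sum_half_le.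
rewrite (reindex_inj rev_ord_inj) /=.
rewrite (eq_bigr (fun i : 'I_N => (2 ^+ i)^-1)) ?sum_half_le // => i _.
by congr (_ ^+ _)^-1; have := ltn_ord i; lia.
Qed.

End weights.

(** * The space of measures on the odometer *)

Section odometer_space.
Variable R : realType.
Implicit Types (x y : nat -> nat -> R[i]).

Definition level_sqnorm x (j : nat) : R :=
  \sum_(k < 4 ^ j) wt R j k * sqnormc (x j k).

Definition level_dot x y (j : nat) : R[i] :=
  \sum_(k < 4 ^ j) (wt R j k)%:C%C * (x j k * (y j k)^*%C).

Lemma level_sqnorm_ge0 x j : 0 <= level_sqnorm x j.
Proof. by apply: sumr_ge0 => k _; rewrite mulr_ge0 ?sqnormc_ge0 // ltW ?wt_gt0. Qed.

Lemma level_sqnorm0 j : level_sqnorm 0 j = 0.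
Proof. by rewrite /level_sqnorm big1 // => k _; rewrite sqnormc0 mulr0. Qed.

Lemma level_sqnormZ a x j : level_sqnorm (a *: x) j = sqnormc a * level_sqnorm x j.
Proof.
rewrite /level_sqnorm mulr_sumr; apply: eq_bigr => k _.
by rewrite (_ : (a *: x) j k = a * x j k) // sqnormcM mulrCA.
Qed.

Lemma level_sqnormD_le t x y j : 0 < t ->
  level_sqnorm (x + y) j <=
    (1 + t) * level_sqnorm x j + (1 + t^-1) * level_sqnorm y j.
Proof.
move=> t0; rewrite /level_sqnorm !mulr_sumr -big_split /=.
apply: ler_sum => k _; rewrite [(1 + t) * _]mulrCA [(1 + t^-1) * _]mulrCA -mulrDr.
by rewrite ler_pM2l ?wt_gt0 // sqnormcD_le.
Qed.

Lemma level_dotxx x j : level_dot x x j = (level_sqnorm x j)%:C%C.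
Proof.
rewrite /level_dot /level_sqnorm rmorph_sum; apply: eq_bigr => k _.
by rewrite mulc_conj -rmorphM.
Qed.

Lemma level_dotDl x x' y j :
  level_dot (x + x') y j = level_dot x y j + level_dot x' y j.
Proof.
rewrite /level_dot -big_split; apply: eq_bigr => k _ /=.
by rewrite !fctE mulrDl mulrDr.
Qed.

Lemma level_dotZl a x y j : level_dot (a *: x) y j = a * level_dot x y j.
Proof.
rewrite /level_dot mulr_sumr; apply: eq_bigr => k _ /=.
by rewrite (_ : (a *: x) j k = a * x j k) //; ring.
Qed.

Lemma level_dotC x y j : level_dot x y j = (level_dot y x j)^*%C.
Proof.
rewrite /level_dot rmorph_sum; apply: eq_bigr => k _ /=.
rewrite !rmorphM /= conjcK oppr0; congr (_ * _); exact: mulrC.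
Qed.

(** This dominates both parts of the inner product series by a convergent series, so absolute
    convergence follows without Cauchy-Schwarz. *)
Lemma level_dot_le x y j :
  `|complex.Re (level_dot x y j)| <= level_sqnorm x j + level_sqnorm y j /\
  `|complex.Im (level_dot x y j)| <= level_sqnorm x j + level_sqnorm y j.
Proof.
rewrite /level_dot /level_sqnorm -big_split /= !raddf_sum.
have E (k : 'I_(4 ^ j)) (z : R[i]) :
    complex.Re ((wt R j k)%:C%C * z) = wt R j k * complex.Re z /\
    complex.Im ((wt R j k)%:C%C * z) = wt R j k * complex.Im z.
  by case: z => a b /=; rewrite !mul0r subr0 addr0.
split; apply: le_trans (ler_norm_sum _ _ _) _; apply: ler_sum => k _.
  apply: (@le_trans _ _ `|wt R j k * complex.Re (x j k * (y j k)^*%C)|).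
    by rewrite -(E k _).1.
  rewrite normrM gtr0_norm ?wt_gt0 // -mulrDr ler_pM2l ?wt_gt0 //.
  exact: ReM_conj_le.
apply: (@le_trans _ _ `|wt R j k * complex.Im (x j k * (y j k)^*%C)|).
  by rewrite -(E k _).2.
rewrite normrM gtr0_norm ?wt_gt0 // -mulrDr ler_pM2l ?wt_gt0 //.
exact: ImM_conj_le.
Qed.

(** A function on Z/4^j is stored as a periodic function on [nat], which keeps shifts free of
    modular arithmetic. The second clause is finite additivity: a cylinder is the disjoint union of
    its four children, whose labels are k + i 4^j. *)
Definition odo_compatible x :=
  (forall j k, x j (k + 4 ^ j)%N = x j k) /\
  (forall j k, x j k = \sum_(i < 4) x j.+1 (k + i * 4 ^ j)%N).

Definition square_summable x := cvgn (series (level_sqnorm x)).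

Definition in_odo_space : pred (nat -> nat -> R[i]) :=
  [pred x | `[< odo_compatible x /\ square_summable x >]].

Lemma square_summableZ a x : square_summable x -> square_summable (a *: x).
Proof.
move=> cx; rewrite /square_summable (_ : level_sqnorm _ = sqnormc a *: level_sqnorm x).
  exact: is_cvg_seriesZ.
by apply/funext => j; rewrite level_sqnormZ.
Qed.

Lemma square_summableD x y :
  square_summable x -> square_summable y -> square_summable (x + y).
Proof.
move=> cx cy.
apply: (@series_le_cvg _ _ (2 *: level_sqnorm x + 2 *: level_sqnorm y)) => [j|j|j|].
- exact: level_sqnorm_ge0.
- by rewrite addr_ge0 // mulr_ge0 // level_sqnorm_ge0.
- have := @level_sqnormD_le 1 x y j ltr01; rewrite invr1.
  by rewrite (_ : 1 + 1 = 2 :> R).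
- by apply: is_cvg_seriesD; exact: is_cvg_seriesZ.
Qed.

Lemma in_odo_space_submod : subsemimod_closed in_odo_space.
Proof.
have in0 : 0 \in in_odo_space.
  apply/asboolP; split; first by split=> // j k; rewrite big1.
  rewrite /square_summable (_ : level_sqnorm 0 = 0); last first.
    by apply/funext => j; rewrite level_sqnorm0.
  rewrite (_ : series 0 = cst 0); first exact: is_cvg_cst.
  by apply/funext => n; rewrite /series /= big1.
split; first split=> //.
  move=> x y /asboolP[[xp xc] sx] /asboolP[[yp yc] sy]; apply/asboolP.
  split; last exact: square_summableD.
  split=> j k; rewrite !fctE ?xp ?yp //.
  by rewrite [in LHS]xc [in LHS]yc -big_split.
move=> a x /asboolP[[xp xc] sx]; apply/asboolP.
split; last exact: square_summableZ.
split=> j k; rewrite !fctE ?xp //.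
by rewrite [in LHS]xc scaler_sumr.
Qed.

HB.instance Definition _ :=
  GRing.isSubmodClosed.Build _ _ in_odo_space in_odo_space_submod.

Definition odo := {x | x \in in_odo_space}.

HB.instance Definition _ := [isSub of odo for @sval _ _].
HB.instance Definition _ := [Choice of odo by <:].
HB.instance Definition _ := [SubChoice_isSubLmodule of odo by <:].

End odometer_space.

(** * The norm of the space *)

Section odometer_norm.
Variable R : realType.
Implicit Types (x y : odo R).

Definition sqn x : R := limn (series (level_sqnorm (val x))).

Lemma odo_period x j k : val x j (k + 4 ^ j)%N = val x j k.
Proof. by case/asboolP: (valP x) => [[+ _] _]; apply. Qed.

Lemma odo_consistent x j k :
  val x j k = \sum_(i < 4) val x j.+1 (k + i * 4 ^ j)%N.
Proof. by case/asboolP: (valP x) => [[_ +] _]; apply. Qed.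

Lemma odo_summable x : square_summable (val x).
Proof. by case/asboolP: (valP x). Qed.

Lemma odo_mod x j k : val x j (k %% 4 ^ j)%N = val x j k.
Proof.
rewrite [in RHS](divn_eq k (4 ^ j)) addnC; elim: (k %/ _)%N => [|q IH].
  by rewrite addn0.
by rewrite mulSn addnCA addnC odo_period.
Qed.

Lemma partial_sqnorm_le_sqn x n : series (level_sqnorm (val x)) n <= sqn x.
Proof.
apply: nondecreasing_cvgn_le; last exact: odo_summable.
by apply: nondecreasing_series => i _ _; exact: level_sqnorm_ge0.
Qed.

Lemma level_sqnorm_le_sqn x j : level_sqnorm (val x) j <= sqn x.
Proof.
apply: le_trans (partial_sqnorm_le_sqn x j.+1).
rewrite /series /= big_nat_recr //= lerDr.
by apply: sumr_ge0 => i _; exact: level_sqnorm_ge0.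
Qed.

Lemma sqn_ge0 x : 0 <= sqn x.
Proof. exact: le_trans (level_sqnorm_ge0 _ _) (level_sqnorm_le_sqn x 0). Qed.

(** Every coordinate is a continuous functional, since all weights are positive. Definiteness of the
    norm and the construction of limits rest on this. *)
Lemma coord_le_sqn x j k : wt R j k * sqnormc (val x j k) <= sqn x.
Proof.
apply: le_trans (level_sqnorm_le_sqn x j).
rewrite /level_sqnorm -odo_mod /wt -amp_mod -/(wt _ _ _).
pose i := Ordinal (ltn_pmod k (expn4_gt0 j)).
rewrite (bigD1 i) //= lerDl; apply: sumr_ge0 => l _.
by rewrite mulr_ge0 ?sqnormc_ge0 // ltW ?wt_gt0.
Qed.

Lemma sqn_eq0 x : sqn x = 0 -> x = 0.
Proof.
move=> x0; apply/val_inj/funext => j; apply/funext => k.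
apply/sqnormc_eq0/eqP; rewrite eq_le sqnormc_ge0 andbT.
by rewrite -(pmulr_rle0 _ (wt_gt0 R j k)) -x0 coord_le_sqn.
Qed.

Lemma sqnZ a x : sqn (a *: x) = sqnormc a * sqn x.
Proof.
rewrite /sqn /= (_ : level_sqnorm _ = sqnormc a *: level_sqnorm (val x)).
  by rewrite lim_seriesZ //; exact: odo_summable.
by apply/funext => j; rewrite level_sqnormZ.
Qed.

Lemma sqn0 : sqn 0 = 0.
Proof. by rewrite -[0](scale0r (0 : odo R)) sqnZ sqnormc0 mul0r. Qed.

Lemma sqnD_le t x y : 0 < t ->
  sqn (x + y) <= (1 + t) * sqn x + (1 + t^-1) * sqn y.
Proof.
move=> t0.
have cZ (k : R) (z : odo R) : cvgn (series (k *: level_sqnorm (val z))).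
  by apply: is_cvg_seriesZ; exact: odo_summable.
have lZ (k : R) (z : odo R) :
    k * sqn z = limn (series (k *: level_sqnorm (val z))).
  by rewrite lim_seriesZ //; exact: odo_summable.
rewrite !lZ -lim_seriesD //; apply: lim_series_le.
- exact: odo_summable.
- exact: is_cvg_seriesD.
- by move=> j; exact: level_sqnormD_le.
Qed.

Definition odo_norm x : R[i] := (Num.sqrt (sqn x))%:C%C.

Lemma odo_normD x y : odo_norm (x + y) <= odo_norm x + odo_norm y.
Proof.
rewrite /odo_norm -rmorphD /= lecR.
have [/eqP x0|x0] := boolP (sqn x == 0).
  by rewrite (sqn_eq0 x0) add0r sqn0 sqrtr0 add0r.
have [/eqP y0|y0] := boolP (sqn y == 0).
  by rewrite (sqn_eq0 y0) addr0 sqn0 sqrtr0 addr0.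
have sx : 0 < Num.sqrt (sqn x) by rewrite sqrtr_gt0 lt_def x0 sqn_ge0.
have sy : 0 < Num.sqrt (sqn y) by rewrite sqrtr_gt0 lt_def y0 sqn_ge0.
rewrite -[leRHS]ger0_norm ?addr_ge0 ?(ltW sx) ?(ltW sy) // -sqrtr_sqr.
apply: ler_wsqrtr.
(* The optimal parameter is t = |y| / |x|, for which the bound is exactly (|x| + |y|)^2; both norms
   are nonzero at this point. *)
apply: le_trans (sqnD_le x y (divr_gt0 sy sx)) _.
rewrite -{2}[sqn x]sqr_sqrtr ?sqn_ge0 // -{3}[sqn y]sqr_sqrtr ?sqn_ge0 //.
rewrite le_eqVlt; apply/orP; left; apply/eqP; field.
by rewrite !gt_eqF.
Qed.

Lemma odo_normZ (a : R[i]) x : odo_norm (a *: x) = `|a| * odo_norm x.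
Proof. by rewrite /odo_norm normc_def sqnZ sqrtrM ?sqnormc_ge0 // -rmorphM. Qed.

Lemma odo_norm_eq0 x : odo_norm x = 0 -> x = 0.
Proof.
move=> /complexI /eqP; rewrite sqrtr_eq0 => x0; apply: sqn_eq0.
by apply/eqP; rewrite eq_le x0 sqn_ge0.
Qed.

HB.instance Definition _ :=
  Lmodule_isNormed.Build R[i] (odo R) odo_normD odo_normZ odo_norm_eq0.

Lemma odo_normE x : `|x| = (Num.sqrt (sqn x))%:C%C.
Proof. by []. Qed.

Lemma odo_norm_lt x (e : R) : 0 < e -> (`|x| < e%:C%C) = (sqn x < e ^+ 2).
Proof.
move=> e0; rewrite odo_normE ltcR -[in LHS](gtr0_norm e0) -sqrtr_sqr.
by rewrite ltr_sqrt // ?exprn_gt0.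
Qed.

Lemma odo_norm_le x (e : R) : 0 <= e -> (`|x| <= e%:C%C) = (sqn x <= e ^+ 2).
Proof.
move=> e0; rewrite odo_normE lecR -[in LHS](ger0_norm e0) -sqrtr_sqr.
by rewrite ler_sqrt // exprn_ge0.
Qed.

End odometer_norm.

(** Radii of balls over [R[i]] are complex numbers; the order on [R[i]] forces the positive ones to
    be real. *)
Lemma gt0_complexE (R : realType) (e : R[i]) :
  0 < e -> 0 < complex.Re e /\ e = (complex.Re e)%:C%C.
Proof. by case: e => a b; rewrite ltcE /= => /andP[/eqP -> ?]. Qed.

Lemma cvg_sumr (R : realType) T (F : set_system T) {FF : ProperFilter F}
    (I : Type) (r : seq I) (f : I -> T -> R) (l : I -> R) :
  (forall i, f i @ F --> l i) ->
  (fun t => \sum_(i <- r) f i t) @ F --> \sum_(i <- r) l i.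
Proof.
move=> fl; elim: r => [|i r IH].
  rewrite big_nil; under eq_fun do rewrite big_nil.
  exact: cvg_cst.
rewrite big_cons; under eq_fun do rewrite big_cons.
exact: cvgD.
Qed.

(** * Completeness and the inner product *)

Section odometer_complete.
Variable R : realType.
Implicit Types (x y : odo R).

Section cauchy_limit.
Variable F : set_system (odo R).
Context {FF : ProperFilter F}.
Hypothesis Fc : cauchy F.

Lemma cauchy_small (e : R) : 0 < e ->
  exists2 A, F A & forall x y, A x -> A y -> sqn (x - y) <= e ^+ 2.
Proof.
move=> e0; have e20 : 0 < e / 2 by rewrite divr_gt0.
have e2C : 0 < (e / 2)%:C%C :> R[i] by rewrite ltcR.
have /cauchyP/(_ _ e2C)[z Fz] := Fc.
exists (ball z (e / 2)%:C%C) => // x y.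
rewrite -!ball_normE /= => zx zy; rewrite -odo_norm_le ?(ltW e0) //.
rewrite (_ : x - y = (z - y) - (z - x)); last by rewrite opprB [RHS]addrC addrA subrK.
apply: le_trans (ler_normB _ _) _; rewrite [e]splitr rmorphD /=.
by rewrite lerD // ltW.
Qed.

(** A Lipschitz functional maps the Cauchy filter to a Cauchy filter on the complete field [R]; it
    is applied to the real and imaginary parts of the coordinates. *)
Lemma coord_cvg (p : odo R -> R) (C : R) :
    (forall x y, (p x - p y) ^+ 2 <= C * sqn (x - y)) ->
  p @ F --> lim (p @ F).
Proof.
move=> pC; suff : cauchy (p @ F) by move=> /cauchy_cvg.
(* With t = e / (|C| + 1), the deviation satisfies |C| t^2 < (|C| + 1)^2 t^2 = e^2; the added 1
   covers C = 0. *)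
apply: cauchy_exP => e e0.
have C0 : 0 < `|C| + 1 by rewrite ltr_wpDl.
have [A FA Ad] := cauchy_small (divr_gt0 e0 C0).
have [x Ax] := filter_ex FA; exists (p x).
suff : F [set y | ball (p x) e (p y)] by [].
apply: filterS FA => y Ay; rewrite /= -ball_normE /=.
have := le_trans (pC x y) (ler_wpM2r (sqn_ge0 _) (ler_norm C)).
move=> /le_trans/(_ (ler_wpM2l (normr_ge0 _) (Ad _ _ Ax Ay))) pe.
rewrite -(@ltr_pXn2r _ 2) ?nnegrE ?(ltW e0) // -normrX ger0_norm ?sqr_ge0 //.
apply: le_lt_trans pe _.
have := divr_gt0 e0 C0; set t := e / _ => t0.
have -> : e = t * (`|C| + 1) by rewrite divfK ?gt_eqF.
by have := normr_ge0 C; set c := `|C| in C0 *; nra.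
Qed.

Let p_re j k (x : odo R) := complex.Re (val x j k).
Let p_im j k (x : odo R) := complex.Im (val x j k).

Let coord_bound j k x y :
  sqnormc (val x j k - val y j k) <= (wt R j k)^-1 * sqn (x - y).
Proof.
rewrite -(ler_pM2l (wt_gt0 R j k)) mulrA divff ?mul1r ?gt_eqF ?wt_gt0 //.
exact: (coord_le_sqn (x - y) j k).
Qed.

Let re_cvg j k : p_re j k @ F --> lim (p_re j k @ F).
Proof.
apply: (@coord_cvg _ (wt R j k)^-1) => x y; apply: le_trans (coord_bound j k x y).
rewrite /p_re /sqnormc; case: (val x j k) (val y j k) => a b [c d] /=.
by rewrite lerDl sqr_ge0.
Qed.

Let im_cvg j k : p_im j k @ F --> lim (p_im j k @ F).
Proof.
apply: (@coord_cvg _ (wt R j k)^-1) => x y; apply: le_trans (coord_bound j k x y).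
rewrite /p_im /sqnormc; case: (val x j k) (val y j k) => a b [c d] /=.
by rewrite lerDr sqr_ge0.
Qed.

Definition coord_lim j k : R[i] :=
  Complex (lim (p_re j k @ F)) (lim (p_im j k @ F)).

Lemma coord_lim_compatible : odo_compatible coord_lim.
Proof.
split=> j k; rewrite /coord_lim.
  have -> : p_re j (k + 4 ^ j)%N = p_re j k.
    by apply/funext => x; rewrite /p_re odo_period.
  by have -> : p_im j (k + 4 ^ j)%N = p_im j k
    by apply/funext => x; rewrite /p_im odo_period.
have E (a b : 'I_4 -> R) : \sum_(i < 4) Complex (a i) (b i) =
    Complex (\sum_(i < 4) a i) (\sum_(i < 4) b i).
  by rewrite !big_ord_recl !big_ord0.
rewrite E; congr Complex; apply/cvg_lim => //.
  rewrite (_ : p_re j k = fun x => \sum_(i < 4) p_re j.+1 (k + i * 4 ^ j)%N x).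
    by apply: cvg_sumr => i; exact: re_cvg.
  by apply/funext => x; rewrite /p_re odo_consistent raddf_sum.
rewrite (_ : p_im j k = fun x => \sum_(i < 4) p_im j.+1 (k + i * 4 ^ j)%N x).
  by apply: cvg_sumr => i; exact: im_cvg.
by apply/funext => x; rewrite /p_im odo_consistent raddf_sum.
Qed.

Let sqnormc_cvg x j k :
  (fun y : odo R => sqnormc (val x j k - val y j k)) @ F -->
    sqnormc (val x j k - coord_lim j k).
Proof.
have E (z w : R[i]) : sqnormc (z - w) =
    (complex.Re z - complex.Re w) ^+ 2 + (complex.Im z - complex.Im w) ^+ 2.
  by case: z w => a b [c d].
rewrite E (_ : (fun y => _) = (fun y => (complex.Re (val x j k) - p_re j k y) ^+ 2 +
    (complex.Im (val x j k) - p_im j k y) ^+ 2)); last first.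
  by apply/funext => y; exact: E.
have cX (u : odo R -> R) (l a : R) : u @ F --> l ->
    (fun y => (a - u y) ^+ 2) @ F --> (a - l) ^+ 2.
  move=> ul; have aul : (fun y => a - u y) @ F --> a - l.
    by apply: cvgB => //; exact: cvg_cst.
  exact: (cvgM aul aul).
by apply: cvgD; apply: cX; [exact: re_cvg | exact: im_cvg].
Qed.

(** A Fatou-type argument: for fixed n only finitely many coordinates occur, so the bound passes to
    the coordinatewise limit. *)
Lemma partial_sqnorm_lim_le (e : R) x n :
    (\forall y \near F, sqn (x - y) <= e) ->
  series (level_sqnorm (val x - coord_lim)) n <= e.
Proof.
move=> xe.
apply: (@cvgr_to_le _ F _ R (fun y => series (level_sqnorm (val (x - y))) n)).
  rewrite /series /=.
  apply: (@cvg_sumr R _ F _ _ _ (fun j y => level_sqnorm (val (x - y)) j)) => j.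
  apply: (@cvg_sumr R _ F _ _ _
    (fun (k : 'I_(4 ^ j)) y => wt R j k * sqnormc (val x j k - val y j k))) => k.
  by apply: cvgM; [exact: cvg_cst | exact: sqnormc_cvg].
by apply: filterS xe => y; apply: le_trans; exact: partial_sqnorm_le_sqn.
Qed.

Lemma square_summable_bounded (z : nat -> nat -> R[i]) (e : R) :
  (forall n, series (level_sqnorm z) n <= e) -> square_summable z.
Proof.
move=> ze; apply: nondecreasing_is_cvgn.
  by apply: nondecreasing_series => i _ _; exact: level_sqnorm_ge0.
by exists e => _ [n _ <-].
Qed.

Lemma odo_near_lim (e : R) : 0 < e -> exists2 A, F A &
  forall x, A x -> forall n, series (level_sqnorm (val x - coord_lim)) n <= e ^+ 2.
Proof.
move=> e0; have [A FA Ae] := cauchy_small e0; exists A => // x Ax n.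
by apply: partial_sqnorm_lim_le; apply: filterS FA => y; exact: Ae.
Qed.

Lemma coord_lim_in : coord_lim \in (@in_odo_space R).
Proof.
have [A FA Ae] := odo_near_lim ltr01; have [x Ax] := filter_ex FA.
apply/asboolP; split; first exact: coord_lim_compatible.
(* The limit is x - (x - limit) for an x close to it: the first term is square summable and the
   second has bounded partial sums. *)
rewrite -(subKr (val x) coord_lim); apply: square_summableD.
  exact: odo_summable.
rewrite -scaleN1r; apply: square_summableZ.
exact: (square_summable_bounded (Ae _ Ax)).
Qed.

Lemma odo_cauchy_cvg : cvg F.
Proof.
apply/cvg_ex; exists (exist _ coord_lim coord_lim_in : odo R).
apply/fcvgrPdist_lt => e /gt0_complexE[]; set r := complex.Re e => r0 ->.
(* Limits preserve only the non-strict bound, so half the radius is used to recover the strict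
   one. *)
have r20 : 0 < r / 2 by rewrite divr_gt0.
have [A FA Ae] := odo_near_lim r20.
apply: filterS FA => x /Ae xe; rewrite distrC odo_norm_lt //.
apply: (@le_lt_trans _ _ ((r / 2) ^+ 2)); last by nra.
rewrite /sqn; apply: limr_le; first exact: odo_summable.
exact: nearW.
Qed.

End cauchy_limit.

HB.instance Definition _ := Uniform_isComplete.Build (odo R) odo_cauchy_cvg.

Lemma level_dot_csummable x y : csummable (level_dot (val x) (val y)).
Proof.
have S : cvgn (series (level_sqnorm (val x) + level_sqnorm (val y))).
  by apply: is_cvg_seriesD; exact: odo_summable.
have S0 j : 0 <= (level_sqnorm (val x) + level_sqnorm (val y)) j.
  by rewrite addr_ge0 // level_sqnorm_ge0.
split; apply: normed_cvg; apply: (series_le_cvg _ S0 _ S) => j //=.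
  by have [] := level_dot_le (val x) (val y) j.
by have [] := level_dot_le (val x) (val y) j.
Qed.

Definition odo_dot x y : R[i] := csum (level_dot (val x) (val y)).

Lemma odo_dotxx x : odo_dot x x = (sqn x)%:C%C.
Proof.
rewrite /odo_dot -csum_real; congr csum; apply/funext => j.
exact: level_dotxx.
Qed.

Lemma odo_dotC x y : odo_dot x y = (odo_dot y x)^*%C.
Proof.
rewrite /odo_dot -csum_conj; last exact: level_dot_csummable.
by congr csum; apply/funext => j; exact: level_dotC.
Qed.

Lemma odo_dotDl y x x' : odo_dot (x + x') y = odo_dot x y + odo_dot x' y.
Proof.
rewrite /odo_dot -csumD; try exact: level_dot_csummable.
by congr csum; apply/funext => j; exact: level_dotDl.
Qed.

Lemma odo_dotZl y a x : odo_dot (a *: x) y = a * odo_dot x y.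
Proof.
rewrite /odo_dot -csumZ; last exact: level_dot_csummable.
by congr csum; apply/funext => j; exact: level_dotZl.
Qed.

Lemma odo_dot_bilinear :
  bilinear_for *%R (Num.conj \; *%R) odo_dot.
Proof.
split=> [y|x] a u v /=; first by rewrite odo_dotDl odo_dotZl.
rewrite [LHS]odo_dotC odo_dotDl odo_dotZl.
by rewrite [odo_dot x u]odo_dotC [odo_dot x v]odo_dotC rmorphD rmorphM.
Qed.

HB.instance Definition _ := bilinear_isBilinear.Build R[i] (odo R) (odo R) R[i]
  *%R (Num.conj \; *%R) odo_dot odo_dot_bilinear.

Let odo_dot_hermitian x y : odo_dot x y = (-1) ^+ false * Num.conj (odo_dot y x).
Proof. by rewrite mul1r; exact: odo_dotC. Qed.

HB.instance Definition _ := isHermitianSesquilinear.Build R[i] (odo R) false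
  Num.conj odo_dot odo_dot_hermitian.

Let odo_dot_gt0 x : x != 0 -> 0 < odo_dot x x.
Proof.
move=> x0; rewrite odo_dotxx ltcR lt_def sqn_ge0 andbT.
by apply: contra_neq x0; exact: sqn_eq0.
Qed.

HB.instance Definition _ := isDotProduct.Build R[i] (odo R) odo_dot odo_dot_gt0.

Let odo_dot_normE x : odo_dot x x = `|x| ^+ 2.
Proof. by rewrite odo_dotxx odo_normE -rmorphXn /= sqr_sqrtr ?sqn_ge0. Qed.

HB.instance Definition _ := BanachSpace_isHilbert.Build R (odo R) odo_dot_normE.

End odometer_complete.

(** * The shift *)

(** Shifting by one only moves the first term to the end of the period. *)
Lemma sum_periodic (V : nmodType) (N : nat) (f : nat -> V) (s : nat) :
  (forall k, f (k + N)%N = f k) -> \sum_(k < N) f (k + s)%N = \sum_(k < N) f k.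
Proof.
move=> fN; elim: s => [|s IH]; first by apply: eq_bigr => k _; rewrite addn0.
rewrite -{}IH; under eq_bigr do rewrite addnS -addSn.
case: N fN => [|N] fN; first by rewrite !big_ord0.
rewrite big_ord_recr big_ord_recl /= addrC; congr (_ + _).
by rewrite addnC fN add0n.
Qed.

Section odometer_shift.
Variable R : realType.
Implicit Types (x y : odo R).

(** The amount may depend on the level so that the inverse shift fits in [nat]: at level j,
    subtracting 1 is adding 4^j - 1. *)
Definition shift_by (s : nat -> nat) (x : nat -> nat -> R[i]) :=
  fun j k => x j (k + s j)%N.

Lemma level_sqnorm_shift_by s x j :
    (forall k, wt R j k <= 16 * wt R j (k + s j)%N) ->
  level_sqnorm (shift_by s (val x)) j <= 16 * level_sqnorm (val x) j.
Proof.
move=> ws; pose f k := wt R j k * sqnormc (val x j k).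
have -> : level_sqnorm (val x) j = \sum_(k < 4 ^ j) f (k + s j)%N.
  rewrite (sum_periodic (f := f)) // => k.
  by rewrite /f wtDperiod odo_period.
rewrite /level_sqnorm mulr_sumr; apply: ler_sum => k _.
by rewrite mulrA ler_wpM2r ?sqnormc_ge0.
Qed.

Lemma shift_by_in s x :
    (forall j k, wt R j k <= 16 * wt R j (k + s j)%N) ->
    (forall j k, val x j (k + s j)%N = val x j (k + s j.+1)%N) ->
  shift_by s (val x) \in (@in_odo_space R).
Proof.
move=> ws xs; apply/asboolP; split; first split.
- by move=> j k; rewrite /shift_by addnAC odo_period.
- move=> j k; rewrite /shift_by xs odo_consistent.
  by apply: eq_bigr => i _; rewrite addnAC.
- apply: (@series_le_cvg _ _ (16 *: level_sqnorm (val x))) => [j|j|j|].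
  + exact: level_sqnorm_ge0.
  + by rewrite mulr_ge0 // level_sqnorm_ge0.
  + exact: level_sqnorm_shift_by.
  + by apply: is_cvg_seriesZ; exact: odo_summable.
Qed.

Lemma shift_by_norm_le s x y :
    (forall j k, wt R j k <= 16 * wt R j (k + s j)%N) ->
    val y = shift_by s (val x) ->
  `|y| <= 4 * `|x|.
Proof.
move=> ws yx; rewrite !odo_normE.
have -> : 4 * (Num.sqrt (sqn x))%:C%C = (4 * Num.sqrt (sqn x))%:C%C :> R[i].
  by rewrite rmorphM rmorph_nat.
rewrite lecR -[4]ger0_norm // -sqrtr_sqr -sqrtrM ?sqr_ge0 //.
apply: ler_wsqrtr; rewrite (_ : 4 ^+ 2 = 16); last by ring.
have c16 : cvgn (series (16 *: level_sqnorm (val x))).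
  by apply: is_cvg_seriesZ; exact: odo_summable.
rewrite -[16 * _](_ : limn (series (16 *: level_sqnorm (val x))) = _).
  apply: lim_series_le => //; first exact: odo_summable.
  by move=> j; rewrite yx; exact: level_sqnorm_shift_by.
by rewrite lim_seriesZ //; exact: odo_summable.
Qed.

Let wt_next j k : wt R j k <= 16 * wt R j (k + 1)%N.
Proof. by rewrite addn1; exact: wt_leS. Qed.

Let wt_prev j k : wt R j k <= 16 * wt R j (k + (4 ^ j).-1)%N.
Proof.
rewrite -wtDperiod -{1}(prednK (expn4_gt0 j)) addnS; exact: wtS_le.
Qed.

Let prev_shift x j k :
  val x j (k + (4 ^ j).-1)%N = val x j (k + (4 ^ j.+1).-1)%N.
Proof.
(* The backward shifts of consecutive levels differ by 3 * 4^j, which is three periods of level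
   j. *)
have -> : (k + (4 ^ j.+1).-1 = k + (4 ^ j).-1 + 4 ^ j + 4 ^ j + 4 ^ j)%N.
  by rewrite expnS; have := expn4_gt0 j; lia.
by rewrite !odo_period.
Qed.

Definition odo_shift x : odo R :=
  exist (fun u => u \in @in_odo_space R) _
    (@shift_by_in (fun=> 1%N) x wt_next (fun _ _ => erefl)).

Definition odo_unshift x : odo R :=
  exist (fun u => u \in @in_odo_space R) _
    (@shift_by_in (fun j => (4 ^ j).-1) x wt_prev (prev_shift x)).

Lemma val_odo_shift x j k : val (odo_shift x) j k = val x j k.+1.
Proof. by rewrite /= /shift_by addn1. Qed.

Lemma odo_shift_linear : linear odo_shift.
Proof. by move=> a x y; apply/val_inj. Qed.

HB.instance Definition _ :=
  GRing.isLinear.Build R[i] (odo R) (odo R) _ odo_shift odo_shift_linear.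

Lemma odo_shift_norm_le x : `|odo_shift x| <= 4 * `|x|.
Proof. exact: (@shift_by_norm_le (fun=> 1%N) x _ wt_next). Qed.

Lemma odo_shift_bounded : bounded_operator odo_shift.
Proof. by exists 4 => x; exact: odo_shift_norm_le. Qed.

Lemma odo_shift_invertible : boundedly_invertible odo_shift.
Proof.
exists odo_unshift; split=> [x|x|].
- apply/val_inj/funext => j; apply/funext => k.
  rewrite /= /shift_by -addnA addn1 prednK ?expn4_gt0 //.
  exact: odo_period.
- apply/val_inj/funext => j; apply/funext => k.
  rewrite /= /shift_by -addnA add1n prednK ?expn4_gt0 //.
  exact: odo_period.
- by exists 4 => x; exact: (@shift_by_norm_le (fun j => (4 ^ j).-1) x _ wt_prev).
Qed.

(** * Absence of eigenvectors *)

Section eigenvector.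
Variables (x : odo R) (lambda : R[i]).
Hypothesis eig : odo_shift x = lambda *: x.

Let iter_eig j k : val x j k = lambda ^+ k * val x j 0.
Proof.
elim: k => [|k IH]; first by rewrite expr0 mul1r.
by rewrite exprS -mulrA -IH -val_odo_shift eig.
Qed.

Let eig_root j : val x j 0 != 0 -> lambda ^+ (4 ^ j) = 1.
Proof.
move=> x0; apply: (mulIf x0); rewrite -iter_eig mul1r.
exact: (odo_period x j 0).
Qed.

(** The eigenvalue is then a 4^j-th root of unity, so the four summands of the compatibility
    relation at label 0 coincide. *)
Let eig_level j : val x j 0 != 0 -> val x j 0 = 4 * val x j.+1 0.
Proof.
move=> x0; rewrite odo_consistent (eq_bigr (fun=> val x j.+1 0)).
  by rewrite sumr_const card_ord mulr_natl.
move=> i _; rewrite add0n iter_eig mulnC exprM eig_root //.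
by rewrite expr1n mul1r.
Qed.

Let eig_decay j m : val x j 0 != 0 -> val x j 0 = 4 ^+ m * val x (j + m)%N 0.
Proof.
move=> x0; elim: m => [|m IH]; first by rewrite expr0 mul1r addn0.
rewrite addnS exprSr -mulrA -eig_level //.
by apply: contra_neq x0; rewrite IH => ->; rewrite mulr0.
Qed.

Lemma odo_eigenvector0 : x = 0.
Proof.
apply: contrapT => xn0.
have [j xj0] : exists j, val x j 0 != 0.
  apply: contra_notP xn0 => /forallNP x0; apply/val_inj/funext => j.
  apply/funext => k; rewrite iter_eig.
  by have /negP := x0 j; rewrite negbK => /eqP ->; rewrite mulr0.
pose c := 16 ^+ j * sqnormc (val x j 0).
have c0 : 0 < c.
  rewrite mulr_gt0 ?exprn_gt0 // lt_def sqnormc_ge0 andbT.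
  by apply: contra_neq xj0; exact: sqnormc_eq0.
(* At label 0, each level multiplies the weight by 16 and divides the squared modulus by 16, so this
   single term keeps the value [c] and the series cannot converge. *)
have cle m : c <= level_sqnorm (val x) (m + j)%N.
  have -> : c = wt R (m + j)%N 0 * sqnormc (val x (m + j)%N 0).
    rewrite /c wt0 (eig_decay m xj0) sqnormcM [(m + j)%N]addnC exprD -!mulrA.
    congr (_ * (_ * _)).
    elim: m => [|m IH]; first by rewrite /sqnormc /= expr1n expr0n addr0.
    rewrite exprS sqnormcM IH exprS; congr (_ * _); apply: complexI.
    by rewrite sqnormcE normr_nat rmorph_nat -natrX.
  have N0 := expn4_gt0 (m + j)%N.
  rewrite /level_sqnorm (bigD1 (Ordinal N0)) //= lerDl.
  by apply: sumr_ge0 => k _; rewrite mulr_ge0 ?sqnormc_ge0 // ltW ?wt_gt0.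
have := cvg_series_cvg_0 (@odo_summable R x).
rewrite -(cvg_shiftn j) => /cvgr_to_ge /(_ (nearW _ cle)).
by rewrite leNgt c0.
Qed.

End eigenvector.

Lemma odo_shift_no_eigenvalue (lambda : R[i]) : ~ is_eigenvalue odo_shift lambda.
Proof. by case=> x x0 /odo_eigenvector0/eqP; apply/negP. Qed.

End odometer_shift.

(** * Separability and the Borel sigma-algebra *)

Section separability.
Variable R : realType.

(** A countable labelling with small fibres for every scale yields a dense sequence by choosing one
    point in each fibre. *)
Lemma dense_sequence_of_labels (V : normedModType R[i]) :
  (forall e : R, 0 < e ->
    exists f : V -> nat, forall x y, f x = f y -> `|x - y| < e%:C%C) ->
  exists p : nat -> V, forall (e : R) x, 0 < e ->
    exists i, `|x - p i| < e%:C%C.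
Proof.
move=> lab.
have /choice[f fP] n : exists f : V -> nat,
    forall x y, f x = f y -> `|x - y| < (n.+1%:R^-1)%:C%C.
  by apply: lab; rewrite invr_gt0.
(* Labels that are not attained get the default point 0, which is harmless: below only the label of
   an actual point x is looked up. *)
pose p (nt : nat * nat) : V := xget 0 [set x | f nt.1 x = nt.2].
exists (fun i => if unpickle i is Some nt then p nt else 0) => e x e0.
have [n ne] : exists n, n.+1%:R^-1 < e.
  have := near_infty_natSinv_lt (PosNum e0) => -[n _ /(_ n (leqnn n))] /=.
  by exists n.
exists (pickle (n, f n x)); rewrite pickleK.
have /(fP n) : f n x = f n (p (n, f n x)).
  have ex : exists y, [set y | f n y = f n x] y by exists x.
  exact: (esym (xgetPex 0 ex)).
by move/lt_trans; apply; rewrite ltcR.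
Qed.

Lemma dense_sequence_separable (V : normedModType R[i]) (p : nat -> V) :
  (forall (e : R) x, 0 < e -> exists i, `|x - p i| < e%:C%C) ->
  separable_space V.
Proof.
move=> pd; exists (range p); first exact: card_image_le.
move=> O [x Ox] oO.
have : nbhs x O by apply: open_nbhs_nbhs; split.
rewrite -nbhs_ballE => -[e /= /gt0_complexE[e0 ->] xO].
have [i xi] := pd _ x e0.
have Opi : O (p i) by apply: xO; rewrite -ball_normE.
by exists (p i).
Qed.

Lemma small_tail (x : odo R) (e : R) : 0 < e ->
  exists J, sqn x - series (level_sqnorm (val x)) J <= e.
Proof.
move=> e0; have /cvgrPdist_le/(_ _ e0)[J _ /(_ J (leqnn J))] := @odo_summable R x.
by exists J; apply: le_trans (ler_norm _) _.
Qed.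

(** Beyond level J the inequality |a - b|^2 <= 2 |a|^2 + 2 |b|^2 bounds the difference by the two
    tails, so x and y need to be compared on finitely many levels only. *)
Lemma sqnB_le_tail (x y : odo R) J :
  sqn (x - y) <= series (level_sqnorm (val (x - y))) J +
    2 * (sqn x - series (level_sqnorm (val x)) J) +
    2 * (sqn y - series (level_sqnorm (val y)) J).
Proof.
apply: limr_le; first exact: odo_summable.
exists J => // n Jn; have {}Jn : (J <= n)%N := Jn.
have split_ser (z : odo R) : series (level_sqnorm (val z)) n =
    series (level_sqnorm (val z)) J + \sum_(J <= j < n) level_sqnorm (val z) j.
  by rewrite /series /= (big_cat_nat (leq0n J) Jn).
have := partial_sqnorm_le_sqn x n; have := partial_sqnorm_le_sqn y n.
rewrite !split_ser => yn xn; rewrite -[leRHS]addrA lerD2l.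
apply: (@le_trans _ _ (\sum_(J <= j < n) (2 * level_sqnorm (val x) j +
    2 * level_sqnorm (val y) j))).
  apply: ler_sum => j _.
  have := @level_sqnormD_le _ 1 (val x) (val (- y)) j ltr01.
  rewrite invr1 (_ : 1 + 1 = 2 :> R) //.
  suff -> : level_sqnorm (val (- y)) j = level_sqnorm (val y) j by [].
  by apply: eq_bigr => k _; rewrite -[in RHS]sqnormcN.
rewrite big_split /= -!mulr_sumr; apply: lerD; rewrite ler_pM2l //.
  by rewrite lerBrDr addrC.
by rewrite lerBrDr addrC.
Qed.

Let cell (m : nat) (x : odo R) (j k : nat) : int * int :=
  (Num.floor (m%:R * complex.Re (val x j k)),
   Num.floor (m%:R * complex.Im (val x j k))).

Let cell_close m x y j k : (0 < m)%N -> cell m x j k = cell m y j k ->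
  sqnormc (val x j k - val y j k) <= 2 / m%:R ^+ 2.
Proof.
move=> m0; have m0R : 0 < m%:R :> R by rewrite ltr0n.
have F (a b : R) : Num.floor (m%:R * a) = Num.floor (m%:R * b) ->
    (a - b) ^+ 2 <= 1 / m%:R ^+ 2.
  move=> fab; have /andP[] := floor_itv (m%:R * a).
  have /andP[] := floor_itv (m%:R * b).
  rewrite fab intrD1; set u := (Num.floor _)%:~R => b1 b2 a1 a2.
  rewrite ler_pdivlMr ?exprn_gt0 // -exprMn mulrC mulrBr.
  by nra.
rewrite /cell /sqnormc; case: (val x j k) (val y j k) => a b [c d] /= [/F + /F].
by move=> ac bd; have := lerD ac bd; rewrite -mulrDl.
Qed.

Let code (m J : nat) (x : odo R) : seq (seq (int * int)) :=
  mkseq (fun j => mkseq (cell m x j) (4 ^ j)) J.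

Let code_eq m J x y : code m J x = code m J y ->
  forall j k, (j < J)%N -> (k < 4 ^ j)%N -> cell m x j k = cell m y j k.
Proof.
move=> cxy j k jJ kj.
have /(congr1 (fun s => nth (0, 0) s k)) := congr1 (fun s => nth [::] s j) cxy.
by rewrite !nth_mkseq.
Qed.

(** The label of x consists of a level J with a small tail beyond it and of the coordinates below J
    rounded to a fine grid. As J belongs to the label, equal labels share the cutoff and the
    grid. *)
Lemma odo_labels (e : R) : 0 < e ->
  exists f : odo R -> nat, forall x y, f x = f y -> `|x - y| < e%:C%C.
Proof.
(* The two tails, each counted twice, add up to at most 4 * (e^2 / 8) = e^2 / 2; the levels below J
   must stay under the other half. *)
move=> e0; have e80 : 0 < e ^+ 2 / 8 by rewrite divr_gt0 // exprn_gt0.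
have /choice[J JP] x := small_tail x e80.
pose W n : R := \sum_(0 <= j < n) \sum_(k < 4 ^ j) wt R j k.
have W0 n : 0 <= W n.
  by apply: sumr_ge0 => j _; apply: sumr_ge0 => k _; rewrite ltW ?wt_gt0.
(* The grid resolution depends on the cutoff through the total weight [W] of the levels below it. *)
have /choice[m mP] n : exists m, (0 < m)%N /\ W n * (2 / m%:R ^+ 2) < e ^+ 2 / 2.
  have t0 : 0 < 4 * (W n + 1) / e ^+ 2 + 1.
    by rewrite ltr_wpDl // divr_ge0 ?sqr_ge0 // mulr_ge0 // addr_ge0.
  exists (Num.truncn (4 * (W n + 1) / e ^+ 2 + 1)).+1; split=> //.
  have := truncnS_gt (4 * (W n + 1) / e ^+ 2 + 1).
  set q := (Num.truncn _).+1%:R => tq.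
  have q1 : 1 <= q by rewrite ler1n.
  have e2 : 0 < e ^+ 2 by rewrite exprn_gt0.
  rewrite mulrA ltr_pdivrMr; last by rewrite exprn_gt0 // (lt_le_trans _ q1).
  have : 4 * (W n + 1) < q * e ^+ 2.
    by rewrite -ltr_pdivrMr //; apply: lt_trans tq; rewrite ltrDl.
  have := W0 n; set w := W n; set f := e ^+ 2 in e2 * => w0 wq.
  have : q * f <= q ^+ 2 * f by rewrite ler_pM2r // expr2 ler_peMl // (le_trans _ q1).
  by lra.
exists (fun x => pickle (J x, code (m (J x)) (J x) x)) => x y.
move=> /(pcan_inj pickleK) [Jxy]; rewrite -Jxy => /code_eq cxy.
have [m0 mW] := mP (J x).
rewrite odo_norm_lt //; apply: le_lt_trans (sqnB_le_tail x y (J x)) _.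
have := JP y; rewrite -Jxy; have := JP x.
suff : series (level_sqnorm (val (x - y))) (J x) <= W (J x) * (2 / (m (J x))%:R ^+ 2).
  by lra.
rewrite /series /W /= mulr_suml !big_nat; apply: ler_sum => j /= jJ.
rewrite mulr_suml; apply: ler_sum => k _.
by rewrite ler_pM2l ?wt_gt0 //; apply: cell_close => //; apply: cxy.
Qed.

End separability.

(** * A generating pi-system for the Borel sets *)

Section borel_levels.
Variable R : realType.
Implicit Types (x y : odo R) (A : set (odo R)).

Definition level_determined n A :=
  forall x y, val x n =1 val y n -> A x -> A y.

(** By additivity, a level determines all coarser ones through sums. *)
Lemma eq_level_le x y m n : (m <= n)%N -> val x n =1 val y n -> val x m =1 val y m.
Proof.
move=> /subnK <-; elim: (n - m)%N => [//|d IH] xy.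
apply: IH => k; rewrite !odo_consistent.
by apply: eq_bigr => i _; exact: xy.
Qed.

Lemma level_determined_le A m n :
  (m <= n)%N -> level_determined m A -> level_determined n A.
Proof. by move=> mn Am x y /(eq_level_le mn); exact: Am. Qed.

(** On these sets, measurability and invariance reduce to statements about a single residue; they
    form a pi-system which generates the Borel sets by [borel_odoE]. *)
Definition level_borel : set (set (odo R)) :=
  [set A | @measurable _ (borel (odo R)) A /\ exists n, level_determined n A].

Lemma level_borel_setI : setI_closed level_borel.
Proof.
move=> A B [mA [m Am]] [mB [n Bn]]; split; first exact: measurableI.
exists (maxn m n) => x y xy [Ax Bx]; split.
  exact: (level_determined_le (leq_maxl m n) Am xy).
exact: (level_determined_le (leq_maxr m n) Bn xy).
Qed.

Lemma level_borel_setT : level_borel setT.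
Proof. by split; [exact: measurableT | exists 0%N]. Qed.

Definition partial_ball x n (s : R) : set (odo R) :=
  [set y | series (level_sqnorm (val (y - x))) n <= s].

Lemma partial_ball_closed x n s : closed (partial_ball x n s).
Proof.
rewrite -openC openE => y /= /negP; rewrite -ltNge.
set u := series _ n => su.
have [s0|s0] := ltP s 0.
  apply: filterS filterT => z _ /=; apply/negP; rewrite -ltNge.
  apply: lt_le_trans s0 _; apply: sumr_ge0 => j _; exact: level_sqnorm_ge0.
(* With this t, the term t s is less than (u - s) / 2, and [e] makes (1 + 1/t) e^2 equal to (u - s)
   / 2. A point of the ball with partial sum at most s would give u < u. *)
pose t := (u - s) / (2 * (s + 1)).
have t0 : 0 < t by rewrite divr_gt0 ?subr_gt0 // mulr_gt0 // ltr_wpDl.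
have tV0 : 0 < 1 + t^-1 by rewrite addr_gt0 // invr_gt0.
pose e := Num.sqrt ((u - s) / 2 / (1 + t^-1)).
have e0 : 0 < e by rewrite sqrtr_gt0 divr_gt0 // divr_gt0 // subr_gt0.
have : nbhs y (ball y e%:C%C) by apply: nbhsx_ballx; rewrite ltcR.
apply: filterS => z; rewrite -ball_normE /= odo_norm_lt // => yz zs.
have : u <= (1 + t) * s + (1 + t^-1) * sqn (y - z).
  apply: (@le_trans _ _ ((1 + t) * series (level_sqnorm (val (z - x))) n +
      (1 + t^-1) * series (level_sqnorm (val (y - z))) n)).
    rewrite /u /series /= !mulr_sumr -big_split /=; apply: ler_sum => j _.
    rewrite (_ : val y - val x = (val z - val x) + (val y - val z)).
      exact: level_sqnormD_le.
    by rewrite [RHS]addrC addrA subrK.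
  apply: lerD; rewrite ler_pM2l //; first by rewrite addr_gt0.
  exact: partial_sqnorm_le_sqn.
move: yz; rewrite sqr_sqrtr; last first.
  by rewrite divr_ge0 ?ltW // divr_gt0 // subr_gt0.
rewrite ltr_pdivlMr // mulrC => yz.
have ts : t * (2 * (s + 1)) = u - s by rewrite divfK // gt_eqF // mulr_gt0 // ltr_wpDl.
by nra.
Qed.

Lemma partial_ball_level_borel x n s : level_borel (partial_ball x n s).
Proof.
split.
  rewrite -[partial_ball _ _ _]setCK; apply: measurableC.
  apply: sub_sigma_algebra; rewrite openC; exact: partial_ball_closed.
exists n => y z yz; rewrite /partial_ball /=.
suff -> : series (level_sqnorm (val z - val x)) n =
          series (level_sqnorm (val y - val x)) n by [].
rewrite /series /= !big_nat; apply: eq_bigr => j /= jn; apply: eq_bigr => k _.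
by rewrite !fctE (eq_level_le (ltnW jn) yz).
Qed.

Lemma closed_ball_level_borel x (e : R) : 0 < e ->
  <<s level_borel >> [set y | `|y - x| <= e%:C%C].
Proof.
move=> e0.
rewrite (_ : [set y | _] = \bigcap_n partial_ball x n (e ^+ 2)).
  apply: (@bigcapT_measurable _ (g_sigma_algebraType level_borel)) => n.
  by apply: sub_sigma_algebra; exact: partial_ball_level_borel.
apply/seteqP; split => y /=; rewrite odo_norm_le ?(ltW e0) //.
  by move=> ye n _; exact: le_trans (partial_sqnorm_le_sqn (y - x) n) ye.
move=> ye; apply: limr_le; first exact: odo_summable.
by apply: nearW => n; exact: (ye n I).
Qed.

(** By separability an open set is a countable union of closed balls, and each closed ball is the
    countable intersection of partial balls, since the norm is a supremum of partial sums. *)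
Lemma borel_odoE : @measurable _ (borel (odo R)) = <<s level_borel >>.
Proof.
apply/seteqP; split; last first.
  apply: smallest_sub; first exact: sigma_algebra_measurable.
  by move=> A [].
apply: smallest_sub; first exact: smallest_sigma_algebra.
have [p pd] := dense_sequence_of_labels (@odo_labels R).
move=> U /= oU.
pose B i m := [set y : odo R | `|y - p i| <= (m.+1%:R^-1)%:C%C].
rewrite (_ : U = \bigcup_i \bigcup_m (if `[< B i m `<=` U >] then B i m else set0)).
  apply: sigma_algebra_bigcup => i; apply: sigma_algebra_bigcup => m.
  case: ifP => _; last exact: sigma_algebra0.
  by apply: closed_ball_level_borel; rewrite invr_gt0.
apply/seteqP; split => x; last first.
  by case=> i _ [m _]; case: ifP => // /asboolP; apply.
move=> Ux; have : nbhs x U by apply: open_nbhs_nbhs; split.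
rewrite -nbhs_ballE => -[e /= /gt0_complexE[]]; set r := complex.Re e => r0 -> xU.
(* A ball of radius less than r / 2 whose centre is that close to x stays inside the ball of radius
   r around x. *)
have r20 : 0 < r / 2 by rewrite divr_gt0.
have [m _ /(_ m (leqnn m)) /= mr] := near_infty_natSinv_lt (PosNum r20).
have m0 : 0 < m.+1%:R^-1 :> R by rewrite invr_gt0.
have [i xi] := pd _ x m0.
exists i => //; exists m => //; rewrite ifT /B /=; first exact: ltW.
apply/asboolP => y /= yi; apply: xU; rewrite -ball_normE /=.
rewrite (_ : x - y = (x - p i) - (y - p i)); last by rewrite opprB addrA subrK.
apply: le_lt_trans (ler_normB _ _) _; rewrite [r]splitr rmorphD /=.
by rewrite ltrD //; [apply: lt_trans xi _ | apply: le_lt_trans yi _]; rewrite ltcR.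
Qed.

End borel_levels.

(** * Random point masses *)

Lemma eq_measure_full d (T : measurableType d) (R : realType)
    (mu : {measure set T -> \bar R}) (G X Y : set T) :
  measurable G -> mu (~` G) = 0%E -> measurable X -> measurable Y ->
  X `&` G = Y `&` G -> mu X = mu Y.
Proof.
move=> mG G0.
have muG (Z : set T) : measurable Z -> mu Z = mu (Z `&` G).
  move=> mZ; rewrite (measureDI mu mZ mG) -[RHS]add0e; congr (_ + _)%E.
  apply: measure_negligible; first exact: measurableD.
  by exists (~` G); split; [exact: measurableC | exact: G0 | move=> t []].
by move=> mX mY XY; rewrite (muG X) // (muG Y) // XY.
Qed.

Section random_point.
Context {R : realType} {d : measure_display} {Omega : measurableType d}.
(** [omega j t] is the level j residue of a random point of the odometer: the hypotheses make the
    residues consistent and uniform, so the law of the point is Haar measure. *)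
Variables (P : probability Omega R) (omega : nat -> Omega -> nat).
Hypothesis omega_lt : forall j t, (omega j t < 4 ^ j)%N.
Hypothesis omega_mod : forall j t, (omega j.+1 t %% 4 ^ j)%N = omega j t.
Hypothesis omega_meas : forall j m, measurable [set t | omega j t = m].
Hypothesis omega_unif : forall j m, (m < 4 ^ j)%N ->
  P [set t | omega j t = m] = ((4 ^+ j)^-1)%:E.

Lemma omega_preimage_meas (E : set nat) j : measurable [set t | E (omega j t)].
Proof.
rewrite (_ : [set t | _] = \bigcup_(m in E) [set t | omega j t = m]).
  by apply: bigcup_measurable => m _; exact: omega_meas.
by apply/seteqP; split => t /=; [exists (omega j t) | case=> m Em ->].
Qed.

Lemma omega_preimage_prob (E : set nat) j :
  P [set t | E (omega j t)] = \sum_(m < 4 ^ j | `[< E m >]) ((4 ^+ j)^-1)%:E.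
Proof.
rewrite (_ : [set t | _] =
    \big[setU/set0]_(m < 4 ^ j | `[< E m >]) [set t | omega j t = m]).
  rewrite measure_bigsetU_ord.
  - by apply: eq_bigr => m _; exact: omega_unif.
  - by move=> m; exact: omega_meas.
  - by move=> m n _ _ [t [/= tm tn]]; apply: ord_inj; rewrite -tm -tn.
rewrite -bigcup_seq_cond; apply/seteqP; split => t /=.
  move=> Et; exists (Ordinal (omega_lt j t)) => //=.
  by rewrite mem_index_enum; exact/asboolP.
by case=> m /= /andP[_ /asboolP Em] ->.
Qed.

Definition amp_at j t : \bar R := (amp R j (omega j t))%:E.

Lemma amp_atE j t : amp_at j t =
  (\sum_(m < 4 ^ j) (amp R j m)%:E * (\1_[set t | omega j t = m] t)%:E)%E.
Proof.
rewrite (bigD1 (Ordinal (omega_lt j t))) //= big1 => [|m mt].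
  by rewrite adde0 indicE mem_set // mule1.
rewrite indicE memNset ?mule0 //= => tm; move/eqP: mt; apply.
exact/val_inj.
Qed.

Lemma amp_at_meas j : measurable_fun setT (amp_at j).
Proof.
rewrite (funext (amp_atE j)); apply: emeasurable_sum => m.
apply: emeasurable_funM; first exact: measurable_cst.
by apply/measurable_EFinP; exact: measurable_indic.
Qed.

Lemma amp_at_ge0 j t : (0 <= amp_at j t)%E.
Proof. by rewrite lee_fin ltW // amp_gt0. Qed.

(** A uniform residue averages the amplitudes: their sum, at most 4 * 2^j, is divided by 4^j. *)
Lemma integral_amp_at j : (\int[P]_t amp_at j t <= (4 / 2 ^+ j)%:E)%E.
Proof.
have mI (m : nat) : measurable_fun setT
    (fun t => (\1_[set t | omega j t = m] t : R)%:E).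
  by apply/measurable_EFinP; exact: measurable_indic.
under eq_integral do rewrite amp_atE.
rewrite ge0_integral_sum //; last 2 first.
- by move=> m; apply: emeasurable_funM; [exact: measurable_cst | exact: mI].
- by move=> m t _; rewrite mule_ge0 // lee_fin // ltW // amp_gt0.
rewrite (eq_bigr (fun m : 'I_(4 ^ j) => (amp R j m * (4 ^+ j)^-1)%:E)).
  rewrite sumEFin lee_fin -mulr_suml ler_pdivrMr ?exprn_gt0 //.
  apply: le_trans (sum_amp_le R j) _.
  rewrite (_ : 4 ^+ j = 2 ^+ j * 2 ^+ j :> R).
    by rewrite mulrA divfK // expf_neq0.
  by rewrite -exprMn; congr (_ ^+ _); ring.
move=> m _; rewrite (ge0_integralZl _ measurableT (mI m)) ?lee_fin //; last first.
  by rewrite ltW // amp_gt0.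
rewrite integral_indic // setIT [RHS]EFinM; congr (_ * _)%E.
exact: omega_unif.
Qed.

(** Finiteness is asked of the fourth roots of the weights, because the weights themselves have
    expectation at least 16^j / 4^j. *)
Definition good : set Omega := [set t | (\sum_(j <oo) amp_at j t < +oo)%E].

Lemma sum_amp_at_meas : measurable_fun setT (fun t => \sum_(j <oo) amp_at j t)%E.
Proof.
by apply: ge0_emeasurable_sum => // j *; [exact: amp_at_ge0 | exact: amp_at_meas].
Qed.

Lemma good_meas : measurable good.
Proof.
have := emeasurable_fun_infty_o measurableT sum_amp_at_meas +oo%E.
by rewrite setTI.
Qed.

Lemma integral_sum_amp_at : (\int[P]_t \sum_(j <oo) amp_at j t < +oo)%E.
Proof.
rewrite integral_nneseries //; last 2 first.
- exact: amp_at_meas.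
- by move=> j t _; exact: amp_at_ge0.
apply: (@le_lt_trans _ _ (\sum_(j <oo) (4 / 2 ^+ j)%:E)%E).
  apply: lee_nneseries => [j _ _|j _]; last exact: integral_amp_at.
  by apply: integral_ge0 => t _; exact: amp_at_ge0.
apply: (@le_lt_trans _ _ (8%:E)); last exact: ltry.
apply: lime_le.
  by apply: is_cvg_nneseries => j *; rewrite lee_fin divr_ge0 ?exprn_ge0.
apply: nearW => n; rewrite sumEFin lee_fin -mulr_sumr big_mkord.
have := sum_half_le R n; lra.
Qed.

Lemma good_full : P (~` good) = 0%E.
Proof.
apply: measure_negligible; first by apply: measurableC; exact: good_meas.
have S0 t : (0 <= \sum_(j <oo) amp_at j t)%E.
  by apply: nneseries_ge0 => j *; exact: amp_at_ge0.
have : {ae P, forall t, setT t -> (\sum_(j <oo) amp_at j t)%E \is a fin_num}.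
  apply: integrable_ae => //; apply/integrableP; split.
    exact: sum_amp_at_meas.
  by under eq_integral do rewrite gee0_abs //; exact: integral_sum_amp_at.
apply: negligibleS => t /= /negP; rewrite -leNgt leye_eq => /eqP ->.
by move=> /(_ I).
Qed.

Definition delta t : nat -> nat -> R[i] :=
  fun j k => (omega j t == k %% 4 ^ j)%N%:R.

Lemma modn_mul4_digit b r N : (r < N)%N ->
  ((b * N + r) %% (4 * N) = b %% 4 * N + r)%N.
Proof.
move=> rN; rewrite {1}(divn_eq b 4) mulnDl -mulnA -addnA modnMDl modn_small //.
by have := ltn_pmod b (isT : 0 < 4)%N; nia.
Qed.

(** Exactly one of the four children of a cylinder containing the point contains it too. Dividing by
    4^j separates the residue, which must agree at level j, from the next digit, which matches for
    one i only. *)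
Lemma delta_compatible t : odo_compatible (delta t).
Proof.
split=> j k; rewrite /delta; first by rewrite modnDr.
set N := (4 ^ j)%N; have N0 : (0 < N)%N := expn4_gt0 j.
set r := (k %% N)%N; have rN : (r < N)%N := ltn_pmod k N0.
set a := (omega j.+1 t %/ N)%N.
have a4 : (a < 4)%N by rewrite ltn_divLR // -expnS omega_lt.
have -> : \sum_(i < 4) (omega j.+1 t == (k + i * N) %% 4 ^ j.+1)%N%:R =
    \sum_(i < 4) ((omega j t == r) && (a == (k %/ N %% 4 + i) %% 4)%N)%:R :> R[i].
  apply: eq_bigr => i _; congr (_ %:R); congr nat_of_bool.
  rewrite expnS [in LHS](divn_eq k N) -/r addnAC -mulnDl modn_mul4_digit //.
  rewrite modnDml [in LHS](divn_eq (omega j.+1 t) N) omega_mod -/a.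
  set c := ((k %/ N + i) %% 4)%N.
  have sN := omega_lt j t.
  apply/eqP/andP => [E|[/eqP -> /eqP ->] //].
  have := congr1 (modn^~ N) E; rewrite !modnMDl !modn_small // => ->.
  have := congr1 (divn^~ N) E; rewrite !divnMDl // !divn_small // !addn0 => ->.
  by rewrite !eqxx.
have [_|_] /= := eqVneq (omega j t) r; last by rewrite big1.
have := ltn_pmod (k %/ N) (isT : 0 < 4)%N; move: (k %/ N %% 4)%N a4.
case: a => [|[|[|[|//]]]] [|[|[|[|//]]]] _ _;
  by rewrite !big_ord_recl big_ord0 /= ?addr0 ?add0r.
Qed.

Lemma level_sqnorm_delta t j : level_sqnorm (delta t) j = wt R j (omega j t).
Proof.
rewrite /level_sqnorm (bigD1 (Ordinal (omega_lt j t))) //= big1 => [|k kt].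
  rewrite addr0 /delta modn_small // eqxx /sqnormc /=.
  by rewrite expr1n expr0n addr0 mulr1.
rewrite /delta modn_small // (_ : (omega j t == k) = false) ?sqnormc0 ?mulr0 //.
by apply/negbTE; apply: contra_neq kt => kt; apply/val_inj.
Qed.

(** A convergent series of amplitudes has terms bounded by some M, and then amp^4 <= M^3 amp. *)
Lemma delta_summable t : good t -> square_summable (delta t).
Proof.
move=> /nnseries_is_cvg cs.
have {}cs : cvgn (series (fun j => amp R j (omega j t))).
  by apply: cs => j; rewrite ltW // amp_gt0.
have /cvg_seq_bounded/bounded_fun_has_ubound[M sM] := cs.
have aM j : amp R j (omega j t) <= M.
  have /(le_trans _) := sM _ (imageT _ j.+1); apply.
  rewrite /series /= big_nat_recr //= lerDr.
  by apply: sumr_ge0 => i _; rewrite ltW // amp_gt0.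
have M0 : 0 <= M by apply: le_trans (aM 0%N); rewrite ltW // amp_gt0.
apply: (@series_le_cvg _ _ (M ^+ 3 *: (fun j => amp R j (omega j t)))) => [j|j|j|].
- exact: level_sqnorm_ge0.
- by rewrite mulr_ge0 ?exprn_ge0 // ltW // amp_gt0.
- rewrite level_sqnorm_delta /wt exprSr ler_wpM2r ?(ltW (amp_gt0 _ _ _)) //.
  by rewrite lerXn2r ?nnegrE // ltW // amp_gt0.
- exact: is_cvg_seriesZ.
Qed.

(** Off the conull set [good] the value is 0; on it the point mass lies in the space, so the default
    of [insubd] never arises there. *)
Definition random_odo t : odo R :=
  if t \in good then insubd 0 (delta t) else 0.

Lemma val_random_odo t : good t -> val (random_odo t) = delta t.
Proof.
move=> gt; rewrite /random_odo mem_set // insubdK //.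
by apply/asboolP; split; [exact: delta_compatible | exact: delta_summable].
Qed.

(** The residues m for which the point mass at m, seen at level j, is compatible with membership in
    A. *)
Definition level_labels (A : set (odo R)) j : set nat :=
  [set m | exists2 u, A u & forall k, val u j k = (m == k %% 4 ^ j)%N%:R].

Lemma level_labelsP A j m x : level_determined j A ->
  (forall k, val x j k = (m == k %% 4 ^ j)%N%:R) -> A x <-> level_labels A j m.
Proof.
move=> Aj xm; split=> [Ax|[u Au um]]; first by exists x.
by apply: Aj Au => k; rewrite um xm.
Qed.

(** It suffices to test the generating sets. On [good] the preimage is an event about one residue;
    off [good] the vector is constant. *)
Lemma random_odo_meas : measurable_fun setT (random_odo : Omega -> borel (odo R)).
Proof.
apply: (@measurability _ _ Omega (borel (odo R)) setT random_odo _ (@borel_odoE R)).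
move=> _ [A [_ [j Aj]] <-]; rewrite setTI.
have -> : random_odo @^-1` A = (good `&` [set t | level_labels A j (omega j t)])
    `|` (~` good `&` [set _ | A 0]).
  apply/seteqP; split => t /=; have [gt|ngt] := pselect (good t).
  - move=> At; left; split=> //.
    by apply/(level_labelsP Aj _).1: At => k; rewrite val_random_odo.
  - by rewrite /random_odo memNset // => A0; right.
  - case=> [[_ Lt]|[]//]; apply/(level_labelsP Aj _).2: Lt => k.
    by rewrite val_random_odo.
  - by case=> [[]//|[_ A0]]; rewrite /random_odo memNset.
apply: measurableU; apply: measurableI.
- exact: good_meas.
- exact: omega_preimage_meas.
- by apply: measurableC; exact: good_meas.
- have [A0|A0] := pselect (A 0).
    by rewrite (_ : [set _ | _] = setT) //; apply/seteqP; split.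
  by rewrite (_ : [set _ | _] = set0) //; apply/seteqP; split.
Qed.

End random_point.

(** * Invariance and non-triviality of the law *)

Section shift_measurable.
Variable R : realType.

Lemma odo_shift_meas :
  measurable_fun setT (odo_shift (R := R) : borel (odo R) -> borel (odo R)).
Proof.
apply: (@measurability _ _ (borel (odo R)) (borel (odo R)) setT _ (@open (odo R)) erefl).
move=> _ [U oU <-]; rewrite setTI; apply: sub_sigma_algebra => /=.
rewrite openE => x Ux; have : nbhs (odo_shift x) U by apply: open_nbhs_nbhs; split.
rewrite -nbhs_ballE => -[e /= /gt0_complexE[]]; set r := complex.Re e => r0 -> xU.
have r40 : 0 < r / 4 by rewrite divr_gt0.
have : nbhs x (ball x (r / 4)%:C%C) by apply: nbhsx_ballx; rewrite ltcR.
apply: filterS => y; rewrite -ball_normE /= => xy; apply: xU.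
rewrite -ball_normE /= -linearB /=; apply: le_lt_trans (odo_shift_norm_le _) _.
rewrite (_ : r = 4 * (r / 4)); last by rewrite mulrC divfK.
by rewrite rmorphM rmorph_nat ltr_pM2l.
Qed.

End shift_measurable.

Section random_point_law.
Context {R : realType} {d : measure_display} {Omega : measurableType d}.
Variables (P : probability Omega R) (omega : nat -> Omega -> nat).
Hypothesis omega_lt : forall j t, (omega j t < 4 ^ j)%N.
Hypothesis omega_mod : forall j t, (omega j.+1 t %% 4 ^ j)%N = omega j t.
Hypothesis omega_meas : forall j m, measurable [set t | omega j t = m].
Hypothesis omega_unif : forall j m, (m < 4 ^ j)%N ->
  P [set t | omega j t = m] = ((4 ^+ j)^-1)%:E.

Let f : Omega -> odo R := random_odo omega.

Lemma law_level (A : set (odo R)) j (E : set nat) :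
    measurable (A : set (borel (odo R))) ->
    (forall t, good (R := R) omega t -> A (f t) <-> E (omega j t)) ->
  P (f @^-1` A) = \sum_(m < 4 ^ j | `[< E m >]) ((4 ^+ j)^-1)%:E.
Proof.
move=> mA AE; rewrite -(omega_preimage_prob omega_lt omega_meas omega_unif).
apply: (@eq_measure_full _ _ _ P (good (R := R) omega)).
- exact: (good_meas omega_lt omega_meas).
- exact: (good_full omega_lt omega_meas omega_unif).
- by rewrite -[_ @^-1` _]setTI; apply: (random_odo_meas omega_lt omega_mod omega_meas).
- exact: (omega_preimage_meas omega_meas).
- by apply/seteqP; split => t /= [+ gt]; move/(AE t gt).
Qed.

(** At a single level the shift rotates the residues, and a rotation preserves the uniform count. *)
Lemma law_shift (A : set (odo R)) : level_borel A ->
  P (f @^-1` (odo_shift (R := R) @^-1` A)) = P (f @^-1` A).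
Proof.
move=> [mA [j Aj]]; have N0 := expn4_gt0 j.
rewrite (@law_level A j (level_labels A j)) //; last first.
  move=> t gt; apply: level_labelsP => // k.
  by rewrite /f val_random_odo.
(* Reading coordinates at k + 1 moves the point mass from m to m - 1, written as m + (4^j - 1)
   modulo 4^j. *)
rewrite (@law_level _ j (fun m => level_labels A j ((m + (4 ^ j).-1) %% 4 ^ j)%N)).
- rewrite big_mkcond [RHS]big_mkcond /=.
  pose g m : \bar R :=
    if `[< level_labels A j (m %% 4 ^ j)%N >] then ((4 ^+ j)^-1)%:E else 0%E.
  rewrite -[LHS]/(\sum_(m < 4 ^ j) g (m + (4 ^ j).-1)%N).
  rewrite sum_periodic => [|m]; last by rewrite /g modnDr.
  by apply: eq_bigr => m _; rewrite /g modn_small.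
- by rewrite -[_ @^-1` _]setTI; apply: odo_shift_meas.
- move=> t gt; apply: (@level_labelsP _ A j _ (odo_shift (f t)) Aj) => k.
  rewrite val_odo_shift /f val_random_odo // /delta; congr (_ %:R); congr nat_of_bool.
  rewrite -[in RHS](eqn_modDr 1) -addnA addn1 prednK // modnDr addn1.
  by rewrite [in RHS]modn_small.
Qed.

Lemma random_law : exists rho : probability (borel (odo R)) R,
  forall A, rho A = P (f @^-1` A).
Proof.
pose X : {mfun Omega >-> borel (odo R)} :=
  HB.pack (f : Omega -> borel (odo R))
    (isMeasurableFun.Build _ _ _ _ _ (random_odo_meas omega_lt omega_mod omega_meas)).
by exists (distribution P X).
Qed.

(** Two finite measures that agree on a generating pi-system containing the whole space are
    equal. *)
Lemma law_invariant (rho : probability (borel (odo R)) R) :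
  (forall A, rho A = P (f @^-1` A)) ->
  invariant_measure (odo_shift (R := R) : borel (odo R) -> borel (odo R)) rho.
Proof.
move=> rhoE.
pose T : {mfun borel (odo R) >-> borel (odo R)} :=
  HB.pack (odo_shift (R := R) : borel (odo R) -> borel (odo R))
    (isMeasurableFun.Build _ _ _ _ _ (@odo_shift_meas R)).
move=> B mB; rewrite -[LHS]/(distribution rho T B).
have := @measure_unique _ R (borel (odo R)) (@level_borel R) (fun=> setT)
   (@borel_odoE R)
   (@level_borel_setI R) _ _ (distribution rho T) rho _ _ B mB.
apply.
- by move=> _; exact: level_borel_setT.
- by rewrite bigcup_const.
- by move=> A lA; rewrite /= /distribution /pushforward !rhoE; exact: law_shift.
- move=> _; apply: le_lt_trans (probability_le1 (distribution rho T) measurableT) _.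
  exact: ltry.
Qed.

(** The test set looks at level 0 only, where a point mass has squared norm 1 > 1/2. Almost surely
    the random vector avoids this set, while 0 belongs to it. *)
Lemma law_nontrivial (rho : probability (borel (odo R)) R) :
  (forall A, rho A = P (f @^-1` A)) ->
  ~ same_measure rho (\d_((0 : odo R) : borel (odo R))).
Proof.
move=> rhoE; pose B : set (odo R) := partial_ball 0 1 2^-1.
have [mB _] : level_borel B := partial_ball_level_borel 0 1 2^-1.
move=> /(_ B mB) rhoB; have := etrans (esym (rhoE B)) rhoB.
rewrite (@law_level B 0 set0) //; last first.
  move=> t gt; split=> //; rewrite /B /partial_ball /= subr0 /f val_random_odo //.
  rewrite /series /= big_nat1 level_sqnorm_delta //.
  have -> : omega 0 t = 0%N by apply/eqP; rewrite -leqn0; exact: (omega_lt 0 t).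
  by rewrite wt0 expr0; lra.
rewrite big_pred0; last by move=> m; apply/asboolP.
move=> rho0; suff /(etrans rho0)/eqP :
    \d_((0 : odo R) : borel (odo R)) B = 1%E :> \bar R by rewrite eq_sym onee_eq0.
rewrite diracE mem_set // /B /partial_ball /= subr0 /series /= big1 // => i _.
exact: level_sqnorm0.
Qed.

End random_point_law.

(** * A uniform point of the odometer *)

Section uniform_residues.
Variable R : realType.
Implicit Types x : R.

(** The base 4 digits of x in reversed significance: the j-th digit after the point becomes the
    coefficient of 4^(j-1). This makes the residues consistent between levels. *)
Fixpoint residue x (j : nat) : nat :=
  if j is i.+1 then (residue x i + Num.truncn (4 ^+ j * x) %% 4 * 4 ^ i)%N else 0%N.

Lemma residue_lt x j : (residue x j < 4 ^ j)%N.
Proof.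
elim: j => [//|j IH] /=; rewrite expnS.
by have := ltn_pmod (Num.truncn (4 ^+ j.+1 * x)) (isT : 0 < 4)%N; nia.
Qed.

Lemma residue_mod x j : (residue x j.+1 %% 4 ^ j)%N = residue x j.
Proof. by rewrite /= addnC modnMDl modn_small // residue_lt. Qed.

(** Fixing the residue at level j fixes the first j digits of x, hence a quaternary interval of
    length 4^-j; its index n is m with its digits reversed. *)
Lemma residue_itv j m : (m < 4 ^ j)%N -> exists2 n, (n < 4 ^ j)%N &
  forall x, 0 <= x < 1 -> residue x j = m <-> n%:R <= 4 ^+ j * x < n.+1%:R.
Proof.
elim: j m => [|j IH] m.
  rewrite expn0 ltnS leqn0 => /eqP ->; exists 0%N => // x /=.
  by rewrite expr0 mul1r => ->.
rewrite expnS => mj; have N0 := expn4_gt0 j.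
have [n nj nP] := IH _ (ltn_pmod m N0).
have d4 : (m %/ 4 ^ j < 4)%N by rewrite ltn_divLR.
(* The leading digit of m is the newest digit of x, so it becomes the last digit of the index. *)
exists (4 * n + m %/ 4 ^ j)%N => [|x x01]; first lia.
have -> : residue x j.+1 = m <->
    residue x j = (m %% 4 ^ j)%N /\
    (Num.truncn (4 ^+ j.+1 * x) %% 4)%N = (m %/ 4 ^ j)%N.
  rewrite /= [in X in X <-> _](divn_eq m (4 ^ j)) addnC; split=> [E|[-> ->] //].
  have := congr1 (modn^~ (4 ^ j)%N) E; have := congr1 (divn^~ (4 ^ j)%N) E.
  rewrite /= !modnMDl !divnMDl // modn_mod (divn_small (residue_lt x j)).
  by rewrite (divn_small (ltn_pmod m N0)) !addn0 (modn_small (residue_lt x j)).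
have -> := nP x x01.
have -> : 4 ^+ j.+1 * x = 4 * (4 ^+ j * x) by rewrite exprS mulrA.
have : 0 <= 4 ^+ j * x by rewrite mulr_ge0 ?exprn_ge0 //; case/andP: x01.
move: (4 ^+ j * x) => y y0; move: (m %/ 4 ^ j)%N d4 => c c4.
have y40 : 0 <= 4 * y by rewrite mulr_ge0.
have /andP[] := truncn_itv y40; set t := Num.truncn _ => ty yt.
have Sn (k : nat) : k.+1%:R = k%:R + 1 :> R by rewrite -natr1.
rewrite !Sn natrD natrM in yt *.
split=> [[/andP[ny yn] tc]|/andP[ny yn]].
  have tn : t = (4 * n + c)%N.
    have t1 : (4 * n < t.+1)%N by rewrite -(ltr_nat R) Sn natrM; lra.
    have t2 : (t < 4 * n.+1)%N by rewrite -(ltr_nat R) natrM Sn; lra.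
    lia.
  by move: ty yt; rewrite tn natrD natrM => ? ?; apply/andP; split; lra.
have c3 : c%:R <= 3 :> R by rewrite ler_nat.
have tn : t = (4 * n + c)%N.
  have t1 : (4 * n + c < t.+1)%N by rewrite -(ltr_nat R) Sn natrD natrM; lra.
  have t2 : (t < (4 * n + c).+1)%N by rewrite -(ltr_nat R) Sn natrD natrM; lra.
  lia.
split; last by rewrite tn; lia.
by apply/andP; split; have := ler0n R c; lra.
Qed.

(** The value 0 outside the unit interval keeps the bounds and the consistency valid for all reals;
    the uniform law does not charge that region. *)
Definition unit_residue (j : nat) (x : R) : nat :=
  if 0 <= x < 1 then residue x j else 0%N.

Lemma unit_residue_lt j x : (unit_residue j x < 4 ^ j)%N.
Proof. by rewrite /unit_residue; case: ifP; rewrite ?residue_lt ?expn4_gt0. Qed.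

Lemma unit_residue_mod j x : (unit_residue j.+1 x %% 4 ^ j)%N = unit_residue j x.
Proof. by rewrite /unit_residue; case: ifP; rewrite ?residue_mod ?mod0n. Qed.

Lemma unit_residue_cell j m : (m < 4 ^ j)%N -> exists2 n, (n < 4 ^ j)%N &
  [set x | unit_residue j x = m] `&` `[0, 1[%classic =
  `[n%:R / 4 ^+ j, n.+1%:R / 4 ^+ j[%classic.
Proof.
move=> /residue_itv[n nj nP]; exists n => //.
have p0 : 0 < 4 ^+ j :> R by rewrite exprn_gt0.
have E x : (n%:R / 4 ^+ j <= x < n.+1%:R / 4 ^+ j) =
    (n%:R <= 4 ^+ j * x < n.+1%:R).
  by rewrite ler_pdivrMr // ltr_pdivlMr // mulrC.
apply/seteqP; split => x /=; rewrite !in_itv /= E.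
  by rewrite /unit_residue => -[+ x01]; rewrite x01 => /(nP x x01).
move=> xn; have x01 : 0 <= x < 1.
  have /andP[x0 x1] := xn; apply/andP; split.
    by rewrite -(pmulr_rge0 _ p0); apply: le_trans x0.
  rewrite -(ltr_pM2l p0) mulr1; apply: lt_le_trans x1 _.
  by rewrite -natrX ler_nat.
by split=> //; rewrite /unit_residue x01; apply/(nP x x01).
Qed.

Lemma uniform_prob_itv (a b : R) : 0 <= a -> a <= b -> b <= 1 ->
  uniform_prob (@ltr01 R) `[a, b[%classic = (b - a)%:E.
Proof.
move=> a0 ab b1; rewrite /uniform_prob.
rewrite (eq_integral (fun=> 1%E)) => [|x]; last first.
  rewrite inE /= in_itv /= => /andP[ax xb].
  by rewrite /uniform_pdf (le_trans a0 ax) (le_trans (ltW xb) b1) subr0 invr1.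
rewrite integral_cst //= mul1e lebesgue_measure_itv /= lte_fin.
move: ab; rewrite le_eqVlt => /predU1P[->|ab]; first by rewrite ltxx subrr.
by rewrite ab EFinB.
Qed.

Let P : probability _ R := uniform_prob (@ltr01 R).

Let full01 : P (~` `[0, 1[%classic) = 0%E.
Proof.
rewrite probability_setC // /P /= uniform_prob_itv // subr0.
by rewrite -EFinB subrr.
Qed.

Lemma unit_residue_meas j m :
  measurable ([set x | unit_residue j x = m] : set (measurableTypeR R)).
Proof.
have [mj|mj] := ltnP m (4 ^ j); last first.
  rewrite (_ : [set x | _] = set0) //; apply/seteqP; split => // x /= xm.
  by have := unit_residue_lt j x; rewrite xm ltnNge mj.
have [n _ nE] := unit_residue_cell mj.
rewrite -(setUIDK [set x | unit_residue j x = m] `[0, 1[%classic) nE.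
apply: measurableU => //.
(* Outside the unit interval the residue is 0, so the remaining piece is the whole complement for m
   = 0 and empty otherwise. *)
have [m0|m0] := eqVneq m 0%N.
  rewrite (_ : _ `\` _ = ~` `[0, 1[%classic); first exact: measurableC.
  apply/seteqP; split => x /=; first by case.
  rewrite in_itv /= => x01; split=> //.
  by rewrite /unit_residue; case: ifP => //; move/negP: x01.
rewrite (_ : _ `\` _ = set0) //; apply/seteqP; split => // x /= [].
rewrite in_itv /= /unit_residue; case: ifP => // _ m0'.
by rewrite -m0' eqxx in m0.
Qed.

Lemma unit_residue_unif j m : (m < 4 ^ j)%N ->
  P [set x | unit_residue j x = m] = ((4 ^+ j)^-1)%:E.
Proof.
move=> mj; have [n nj nE] := unit_residue_cell mj.
have p0 : 0 < 4 ^+ j :> R by rewrite exprn_gt0.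
rewrite (@eq_measure_full _ _ _ P `[0, 1[%classic _
  `[n%:R / 4 ^+ j, n.+1%:R / 4 ^+ j[%classic) //.
- rewrite /P /= uniform_prob_itv.
  + by rewrite -mulrBl -natr1 addrAC subrr add0r mul1r.
  + by rewrite divr_ge0 // ltW.
  + by rewrite ler_pM2r ?invr_gt0 // ler_nat.
  + by rewrite ler_pdivrMr // mul1r -natrX ler_nat.
- exact: unit_residue_meas.
- by rewrite -nE -setIA setIid.
Qed.

End uniform_residues.

Theorem theorem1p3 (R : realType) :
  exists (H : hilbertType R) (T : {linear H -> H})
         (rho : probability (borel H) R),
    separable_space H /\
    bounded_operator T /\
    boundedly_invertible T /\
    (forall lambda : R[i], ~ is_eigenvalue T lambda) /\
    invariant_measure (T : borel H -> borel H) rho /\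
    ~ same_measure rho (\d_((0 : H) : borel H) : {measure set (borel H) -> \bar R}).
Proof.
(* The random point of the odometer is drawn from the real line with the uniform law on the unit
   interval. *)
have [rho rhoE] := @random_law R _ (measurableTypeR R) (uniform_prob (@ltr01 R))
  (@unit_residue R) (@unit_residue_lt R) (@unit_residue_mod R) (@unit_residue_meas R).
exists (odo R), (odo_shift (R := R)), rho.
split.
  have [p pd] := dense_sequence_of_labels (@odo_labels R).
  exact: dense_sequence_separable pd.
split; first exact: odo_shift_bounded.
split; first exact: odo_shift_invertible.
split; first exact: odo_shift_no_eigenvalue.
split.
  exact: (@law_invariant R _ (measurableTypeR R) _ _ (@unit_residue_lt R)
    (@unit_residue_mod R) (@unit_residue_meas R) (@unit_residue_unif R) rho rhoE).
exact: (@law_nontrivial R _ (measurableTypeR R) _ _ (@unit_residue_lt R)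
  (@unit_residue_mod R) (@unit_residue_meas R) (@unit_residue_unif R) rho rhoE).
Qed.
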